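(* Let $A$ be a finite set of at least $250$ points in $\mathbb R^2$ that is not contained in any cubic. Then there is a cubic that contains exactly nine points of $A$.
   Context: A cubic is an algebraic curve of degree three, i.e. the zero set in $\mathbb R^2$ of a real polynomial of degree three in two variables; the polynomial is not required to be irreducible. *)

(* Defs.v *)
From mathcomp Require Import all_boot all_order all_algebra.
From mathcomp Require Import boolp classical_sets reals.
From mathcomp Require Import mpoly.

Set Implicit Arguments.
Unset Strict Implicit.
Unset Printing Implicit Defensive.

Import GRing.Theory.
Local Open Scope ring_scope.
Local Open Scope classical_set_scope.

Definition zero_set (R : realType) (p : {mpoly R[2]}) : set 'rV[R]_2 :=
  [set x | p.@[x ord0] = 0].

(* [msize p] is one more than the total degree of a nonzero [p]. *)
Definition is_cubic (R : realType) (C : set 'rV[R]_2) : Prop :=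
  exists2 p : {mpoly R[2]}, msize p = 4%N & C = zero_set p.

(* Main.v *)
(* It suffices to find a set F of nine points of A that contains every point of A lying on all the cubics through F: a cubic through F that is generic among those then meets A in F only.

In the general case, where A has at most twelve points on each line and on each irreducible conic, a greedy choice gives seven points S of A, no three on a line and no six on a conic. The cubics through S form a net, which maps the remaining points to a plane. The cubics through S and one more point b have at most nine common points in A; if they have nine, these are F. Otherwise the map is injective and the image is not contained in a line, so by the Sylvester-Gallai theorem some line contains exactly two image points; it corresponds to a cubic through S and exactly two further points of A.

If some line or irreducible conic c of degree e contains at least thirteen points of A, one takes 3e points of S on c and 7 - 3e off c. Then the net contains a pencil of cubics divisible by c, and all the points of A on c outside S go to the centre of that pencil, put at the vertical point at infinity; the ordinary line has to avoid it, which is why a version of Sylvester-Gallai with a non-vertical ordinary line is needed. The choice of S ensures that the points of A off c do not all lie on a line of the net. *)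

Require Import Defs.
From mathcomp Require Import all_boot all_order all_algebra finmap.
From mathcomp Require Import boolp classical_sets reals.
From mathcomp Require Import mpoly.
From mathcomp Require Import ring zify.

Set Implicit Arguments.
Unset Strict Implicit.
Unset Printing Implicit Defensive.

Import Order.TTheory GRing.Theory Num.Theory.
Local Open Scope fset_scope.
Local Open Scope ring_scope.

(** Cubics form a space of dimension ten, so seven independent base points leave a net, and an
    ordinary line of its plane adds two points to these seven. The obstacle is the fibres of the
    map: a point of [A] common to all cubics through [S] and [b] would come along unasked. Hence the
    condition that [S] with [b] added has no four points on a line and no seven on a conic; it
    limits the base points of the pencil to nine. Bezout's theorem is replaced by dimension counts.
    A failure of independence is concentrated in a circuit, and deleting the points of a line from a
    circuit lowers its degree by one. The constant 250: six chosen points have at most 15 joining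
    lines, each with at most 10 further points of [A], and at most 6 conics through five of them,
    each with at most 12 points, so at most 6 + 150 + 72 = 228 points are excluded. The constant 13:
    [3 * e + 1] points on the heavy curve of degree [e] are needed, since so many zeros force a
    cubic to contain it, and a matching may spoil half of the candidates. For a conic 13 = 2 * 7 -
    1; for a line six points are lost beforehand to the lines joining four outside points, and 13 -
    6 = 2 * 4 - 1. *)

Definition ncoef d := 'C(d.+2, 2).

(** Makes [ncoef d] the dimension of the space of polynomials of degree at most [d]: 3, 6, 10, 15
    for degrees one to four. *)
Lemma card_bmnm2 d : #|{: 'X_{1..2 < d.+1}}| = ncoef d.
Proof.
pose T := [pred x : 'I_d.+1 * 'I_d.+1 | (x.2 < d.+1 - x.1)%N].
have mdeg2 (m : 'X_{1..2}) : mdeg m = (m ord0 + m ord_max)%N.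
  by rewrite mdegE !big_ord_recl big_ord0 addn0; congr (_ + m _)%N; apply/val_inj.
have ltm (m : 'X_{1..2 < d.+1}) : (m ord0 + m ord_max < d.+1)%N.
  by rewrite -mdeg2 bmdeg.
pose f (m : 'X_{1..2 < d.+1}) : 'I_d.+1 * 'I_d.+1 := (inord (m ord0), inord (m ord_max)).
have f_inj : injective f.
  move=> m1 m2 [/(congr1 val) e1 /(congr1 val) e2].
  have := ltm m1; have := ltm m2 => l2 l1.
  move: e1 e2; rewrite /= !inordK; try lia.
  move=> e1 e2; apply/eqP; rewrite bmeqP; apply/eqP/mnmP => i.
  case: i => [[|[|//]] hi].
    by rewrite (_ : Ordinal hi = ord0) //; apply/val_inj.
  by rewrite (_ : Ordinal hi = ord_max) //; apply/val_inj.
transitivity #|T|.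
  rewrite -(card_codom f_inj); apply/eq_card => x; rewrite !inE.
  apply/codomP/idP => [[m ->]|xT].
    by rewrite /= !inordK; have := ltm m; lia.
  have lt_m : (mdeg [multinom (if i == ord0 then x.1 : nat else x.2 : nat) | i < 2] < d.+1)%N.
    by rewrite mdeg2 !mnmE /=; lia.
  exists (BMultinom lt_m).
  by rewrite /f /= !mnmE /= !inord_val; case: x {lt_m xT}.
rewrite -sum1_card -(pair_big_dep xpredT (fun i j : 'I_d.+1 => (j < d.+1 - i)%N) (fun _ _ => 1%N)) /=.
rewrite (eq_bigr (fun i : 'I_d.+1 => (rev_ord i).+1)) => [|i _]; last first.
  rewrite -(big_ord_widen _ (fun _ => 1%N)) ?leq_subr // sum1_card card_ord.
  by rewrite /= subSS subSn // -ltnS.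
rewrite (reindex_inj rev_ord_inj) /= /ncoef -bin2_sum big_mkord [RHS]big_ord_recl /=.
by rewrite add0n; apply: eq_bigr => i _; rewrite /= /bump /=; have := ltn_ord i; lia.
Qed.

(** * Polynomials of bounded degree and linear algebra on their coefficients *)

Section Polynomials.
Variable R : realFieldType.
Implicit Types (p q f g h l : {mpoly R[2]}) (a b x y z : 'rV[R]_2).
Implicit Types (X Y Z E D S T G : {fset 'rV[R]_2}) (d e : nat).

Definition ev a p : R := p.@[a ord0].

Lemma evD a p q : ev a (p + q) = ev a p + ev a q. Proof. exact: mevalD. Qed.
Lemma evN a p : ev a (- p) = - ev a p. Proof. exact: mevalN. Qed.
Lemma evB a p q : ev a (p - q) = ev a p - ev a q. Proof. exact: mevalB. Qed.
Lemma evM a p q : ev a (p * q) = ev a p * ev a q. Proof. exact: mevalM. Qed.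
Lemma evZ a c p : ev a (c *: p) = c * ev a p. Proof. exact: mevalZ. Qed.
Lemma evC a c : ev a c%:MP = c. Proof. exact: mevalC. Qed.
Lemma ev0 a : ev a 0 = 0. Proof. exact: meval0. Qed.
Lemma ev1 a : ev a 1 = 1. Proof. exact: meval1. Qed.
Lemma ev_sum (I : Type) (r : seq I) a (F : I -> {mpoly R[2]}) :
  ev a (\sum_(i <- r) F i) = \sum_(i <- r) ev a (F i).
Proof. exact: raddf_sum. Qed.

Definition evE := (evD, evN, evM, evZ, evC, ev0, ev1).

(** A bound rather than an equality, so that these polynomials, zero included, form a vector
    space. *)
Definition deg_le d p := (msize p <= d.+1)%N.

Lemma deg_leW d e p : (d <= e)%N -> deg_le d p -> deg_le e p.
Proof. by rewrite /deg_le; lia. Qed.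

Lemma deg_le0 d : deg_le d 0. Proof. by rewrite /deg_le msize0. Qed.

Lemma deg_leC d c : deg_le d c%:MP.
Proof. by rewrite /deg_le msizeC; case: (c != 0). Qed.

Lemma deg_leX d i : (0 < d)%N -> deg_le d 'X_i.
Proof. by rewrite /deg_le msizeX mdeg1. Qed.

Lemma deg_leZ d c p : deg_le d p -> deg_le d (c *: p).
Proof. by apply/leq_trans/msizeZ_le. Qed.

Lemma deg_leN d p : deg_le d p -> deg_le d (- p).
Proof. by rewrite /deg_le msizeN. Qed.

Lemma deg_leD d p q : deg_le d p -> deg_le d q -> deg_le d (p + q).
Proof. by rewrite /deg_le => hp hq; apply: leq_trans (msizeD_le _ _) _; rewrite geq_max hp. Qed.

Lemma deg_leB d p q : deg_le d p -> deg_le d q -> deg_le d (p - q).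
Proof. by move=> hp hq; apply/deg_leD/deg_leN. Qed.

Lemma deg_leM d e p q : deg_le d p -> deg_le e q -> deg_le (d + e) (p * q).
Proof.
rewrite /deg_le => hp hq; have [->|p0] := eqVneq p 0; first by rewrite mul0r msize0.
have [->|q0] := eqVneq q 0; first by rewrite mulr0 msize0.
rewrite msizeM //.
by case: (msize p) (msize q) hp hq => [|m] [|n]; lia.
Qed.

Lemma deg_le_sum (I : eqType) (r : seq I) d (F : I -> {mpoly R[2]}) :
  {in r, forall i, deg_le d (F i)} -> deg_le d (\sum_(i <- r) F i).
Proof.
move=> hF; rewrite big_seq; elim/big_rec: _ => [|i p ir hp]; first exact: deg_le0.
by apply: deg_leD => //; apply: hF.
Qed.

Lemma lin_dep d (ps : seq {mpoly R[2]}) :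
  {in ps, forall p, deg_le d p} -> (ncoef d < size ps)%N ->
  exists2 c : nat -> R, exists2 i, (i < size ps)%N & c i != 0 &
    \sum_(i < size ps) c i *: ps`_i = 0.
Proof.
move=> hps; rewrite -card_bmnm2; set m := #|_| => lt_m.
pose M := \matrix_(i < size ps, j < m) (ps`_i)@_(bmnm (enum_val j)).
have /rowV0Pn[v /sub_kermxP vM v0] : kermx M != 0.
  by rewrite kermx_eq0 -row_leq_rank -ltnNge (leq_ltn_trans (rank_leq_col M)).
exists (fun i => if insub i is Some j then v ord0 j else 0).
  case/rV0Pn: v0 => j vj; exists j => //.
  by rewrite insubT //= => lt_j; rewrite (_ : Sub _ _ = j) //; apply/val_inj.
rewrite (eq_bigr (fun i : 'I_(size ps) => v ord0 i *: ps`_i)) => [|i _]; last first.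
  by rewrite insubT //= => lt_i; congr (v _ _ *: _); apply/val_inj.
have hs : deg_le d (\sum_(i < size ps) v ord0 i *: ps`_i).
  by apply: deg_le_sum => i _; apply/deg_leZ/hps/mem_nth.
apply/mpolyP => u; rewrite mcoeff0.
have [lt_u|ge_u] := ltnP (mdeg u) d.+1; last first.
  by apply/memN_msupp_eq0/msize_mdeg_ge/(leq_trans hs).
have := congr1 (fun w : 'rV_m => w ord0 (enum_rank (BMultinom lt_u))) vM.
rewrite !mxE => <-; rewrite raddf_sum; apply: eq_bigr => i _ /=.
by rewrite mcoeffZ mxE enum_rankK.
Qed.

Lemma vanishing_exists d Z : (#|` Z| < ncoef d)%N ->
  exists p, [/\ p != 0, deg_le d p & {in Z, forall z, ev z p = 0}].
Proof.
rewrite -card_bmnm2; set m := #|_| => lt_m.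
pose M := \matrix_(i < m, j < size Z)
  ev (nth 0 Z j) 'X_[bmnm (enum_val i)].
have /rowV0Pn[v /sub_kermxP vM v0] : kermx M != 0.
  by rewrite kermx_eq0 -row_leq_rank -ltnNge (leq_ltn_trans (rank_leq_col M)).
pose E (u : 'X_{1..2}) :=
  if insub u is Some w then v ord0 (enum_rank (w : 'X_{1..2 < d.+1})) else 0.
have EE (w : 'X_{1..2 < d.+1}) : E w = v ord0 (enum_rank w) by rewrite /E valK.
exists (\sum_(u : 'X_{1..2 < d.+1}) E u *: 'X_[R, u]); split.
- case/rV0Pn: v0 => j vj; apply: contraNneq vj => p0.
  by rewrite -[j]enum_valK -EE -(mcoeff_mpoly _ (bmdeg _)) p0 mcoeff0.
- apply: deg_le_sum => u _; apply: deg_leZ.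
  by rewrite /deg_le msizeX; apply: bmdeg.
- move=> z zZ; have lt_z : (index z Z < size Z)%N by rewrite index_mem.
  have := congr1 (fun w : 'rV_(size Z) => w ord0 (Ordinal lt_z)) vM.
  rewrite !mxE ev_sum => vz; rewrite -[RHS]vz [LHS](reindex (fun i : 'I_m => enum_val i)) /=; last first.
    by exists enum_rank => u _; rewrite (enum_valK, enum_rankK).
  by apply: eq_bigr => i _; rewrite evZ EE enum_valK mxE /= nth_index.
Qed.
End Polynomials.

(** * Points imposing independent conditions *)

Section Independence.
Variable R : realFieldType.
Implicit Types (p q f g h l : {mpoly R[2]}) (a b x y z : 'rV[R]_2).
Implicit Types (X Y Z E D S T G : {fset 'rV[R]_2}) (d e : nat).

Definition separated d Y z := exists p,
  [/\ deg_le d p, ev z p != 0 & {in Y, forall y, y != z -> ev y p = 0}].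

(** The evaluations at the points of [Y] are linearly independent on polynomials of degree at most
    [d]; the separators are dual to them. *)
Definition indep d Y := {in Y, forall z, separated d Y z}.

Lemma separatedS d Y Y' z : Y' `<=` Y -> separated d Y z -> separated d Y' z.
Proof.
by move=> /fsubsetP sY [p [hp pz pY]]; exists p; split=> // y /sY; apply: pY.
Qed.

Lemma indepS d Y Y' : Y' `<=` Y -> indep d Y -> indep d Y'.
Proof. by move=> sY iY z /(fsubsetP sY)/iY; apply: separatedS. Qed.

Lemma indepW d e Y : (d <= e)%N -> indep d Y -> indep e Y.
Proof.
by move=> de iY z /iY[p [hp pz pY]]; exists p; split=> //; apply: deg_leW hp.
Qed.

Lemma fset_card_ind (P : {fset 'rV[R]_2} -> Prop) :
  (forall Y, (forall Y', (#|` Y'| < #|` Y|)%N -> P Y') -> P Y) -> forall Y, P Y.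
Proof.
move=> IH Y; have [n] := ubnP #|` Y|; elim: n Y => // n IHn Y ltY.
by apply: IH => Y' ltY'; apply: IHn; apply: leq_trans ltY' _.
Qed.

(* A minimal set in which [z] is not separated is a circuit: if some [g] separated another point [y] in it, subtracting a multiple of [g] from a polynomial that separates [z] away from [y] would separate [z]. *)
Lemma circuit_exists d Y : ~ indep d Y ->
  exists D, [/\ D `<=` Y, D != fset0 & {in D, forall z, ~ separated d D z}].
Proof.
move=> niY; have {niY}[z zY nz] : exists2 z, z \in Y & ~ separated d Y z.
  by apply: contrapT => nY; apply: niY => z zY; apply: contrapT => nz; apply: nY; exists z.
elim/fset_card_ind: Y zY nz => Y IH zY nz.
have [[y [yY yz ny]]|minY] := pselect (exists y, [/\ y \in Y, y != z & ~ separated d (Y `\ y) z]).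
  have ltY : (#|` Y `\ y| < #|` Y|)%N by rewrite (cardfsD1 y Y) yY.
  have zYy : z \in Y `\ y by rewrite in_fsetD1 eq_sym yz.
  have [D [sD D0 cD]] := IH _ ltY zYy ny.
  by exists D; split=> //; apply: fsubset_trans sD (fsubD1set _ _).
exists Y; split=> //; first by apply/fset0Pn; exists z.
move=> y yY; have [->//|yz] := eqVneq y z; move=> [g [hg gy gY]]; apply: nz.
have [f [hf fz fY]] : separated d (Y `\ y) z.
  by apply: contrapT => ny; apply: minY; exists y.
exists (f - (ev y f / ev y g) *: g); split.
- by apply/deg_leB/deg_leZ.
- by rewrite evB evZ (gY z zY) ?mulr0 ?subr0 // eq_sym.
- move=> x xY xz; rewrite evB evZ; have [->|xy] := eqVneq x y.
    by rewrite divfK // subrr.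
  by rewrite (gY x xY xy) mulr0 subr0 fY // in_fsetD1 xy.
Qed.

(** Separators of the points of [Z] together with [ps] are too many to be independent, and
    evaluating a relation at a point of [Z] isolates the coefficient of its separator. So the
    polynomials vanishing on [Z] form a space of dimension at most [ncoef d] minus the size of
    [Z]. *)
Lemma indep_dep d Z (ps : seq {mpoly R[2]}) : indep d Z ->
  {in ps, forall p, deg_le d p} -> {in ps, forall p, {in Z, forall z, ev z p = 0}} ->
  (ncoef d < #|` Z| + size ps)%N ->
  exists2 c : nat -> R, exists2 i, (i < size ps)%N & c i != 0 &
    \sum_(i < size ps) c i *: ps`_i = 0.
Proof.
move=> iZ hps psZ lt_d.
have /choice[e he] : forall z, exists p, z \in Z ->
    [/\ deg_le d p, ev z p != 0 & {in Z, forall y, y != z -> ev y p = 0}].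
  by move=> z; have [/iZ[p hp]|_] := boolP (z \in Z); [exists p | exists 0].
have [||c [i lt_i ci]] := @lin_dep _ d ([seq e z | z <- Z] ++ ps).
- move=> p; rewrite mem_cat => /orP[/mapP[z zZ ->]|/hps//].
  by have [] := he z zZ.
- by rewrite size_cat size_map.
rewrite -(big_mkord xpredT (fun i => c i *: ([seq e z | z <- Z] ++ ps)`_i)).
rewrite size_cat size_map in lt_i *.
rewrite (big_cat_nat (leq0n _) (leq_addr _ _)) /=.
rewrite -[X in _ + \sum_(X <= _ < _) _]add0n big_addn addKn => eq0.
have cZ0 j : (j < size Z)%N -> c j = 0.
  move=> lt_j; have zjZ : Z`_j \in Z by apply: mem_nth.
  have [_ ez _] := he _ zjZ.
  have := congr1 (ev Z`_j) eq0; rewrite evD !ev_sum ev0 [X in _ + X]big1_seq; last first.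
    move=> k /andP[_]; rewrite mem_index_iota => /andP[_ lt_k].
    rewrite evZ nth_cat size_map ltnNge leq_addl /= addnK.
    by rewrite (psZ _ (mem_nth _ lt_k) _ zjZ) mulr0.
  rewrite addr0 big_mkord (bigD1 (Ordinal lt_j)) //= big1 ?addr0; last first.
    move=> k kj; rewrite evZ nth_cat size_map ltn_ord (nth_map 0) //.
    have [_ _ ek] := he _ (mem_nth 0 (ltn_ord k)); rewrite ek ?mulr0 //.
    rewrite nth_uniq ?fset_uniq //.
    by apply: contraNneq kj => jk; apply/eqP/val_inj.
  rewrite evZ nth_cat size_map lt_j (nth_map 0) // => /eqP.
  by rewrite mulf_eq0 (negPf ez) orbF => /eqP.
have ge_i : (size Z <= i)%N by rewrite leqNgt; apply: contra ci => /cZ0 ->.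
exists (fun i => c (i + size Z)%N); first by exists (i - size Z)%N; rewrite ?subnK // -(ltn_add2l (size Z)) subnKC.
rewrite -[RHS]eq0 [X in X + _]big1_seq ?add0r; last first.
  by move=> k /andP[_]; rewrite mem_index_iota => /cZ0->; rewrite scale0r.
rewrite big_mkord; apply: eq_bigr => k _.
by rewrite nth_cat size_map ltnNge leq_addl /= addnK.
Qed.

End Independence.

(** * Consequences of dimension counts; lower bounds on the size of circuits *)

Section Circuits.
Variable R : realFieldType.
Implicit Types (p q f g h l : {mpoly R[2]}) (a b x y z : 'rV[R]_2).
Implicit Types (X Y Z E D S T G : {fset 'rV[R]_2}) (d e : nat).

Lemma unisolvent d Z p : indep d Z -> (ncoef d <= #|` Z|)%N ->
  deg_le d p -> {in Z, forall z, ev z p = 0} -> p = 0.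
Proof.
move=> iZ hZ hp pZ.
have [q|q||c [i]] := @indep_dep _ d Z [:: p] iZ; rewrite ?inE.
- by move=> /eqP->.
- by move=> /eqP->.
- by rewrite addn1.
case: i => // _ c0; rewrite big_ord1 /= => /eqP.
by rewrite scaler_eq0 (negPf c0) /= => /eqP.
Qed.

(** Used as uniqueness of the line through two points and of the conic through five independent
    ones. *)
Lemma proportional d Z p q : indep d Z -> (ncoef d <= #|` Z|.+1)%N ->
  deg_le d p -> deg_le d q -> {in Z, forall z, ev z p = 0} ->
  {in Z, forall z, ev z q = 0} -> q != 0 -> exists c, p = c *: q.
Proof.
move=> iZ hZ hp hq pZ qZ q0.
have [r|r||c [i lt_i ci]] := @indep_dep _ d Z [:: p; q] iZ; rewrite ?inE.
- by case/orP=> /eqP->.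
- by case/orP=> /eqP->.
- by rewrite addn2.
rewrite !big_ord_recl big_ord0 /= addr0 => eq0.
have [c0|c0] := eqVneq (c 0%N) 0.
  move: eq0; rewrite c0 scale0r add0r => /eqP; rewrite scaler_eq0 (negPf q0) orbF.
  by case: i lt_i ci => [|[|//]] _; rewrite ?c0 ?eqxx // => /negPf->.
exists (- (c 1%N / c 0%N)).
rewrite -[LHS]scale1r -(mulVf c0) -scalerA scaleNr mulrC -scalerA -scalerN; congr (_ *: _).
by apply/eqP; rewrite -addr_eq0 eq0.
Qed.

(** Stands in for Bezout: the products of [c] with the monomials of degree at most [d - e] are
    independent and already fill the space that [Z] leaves, so [p] is a combination of them. For
    cubics four points suffice on a line, and seven independent ones on a conic. *)
Lemma curve_divides d e c Z p : deg_le e c -> c != 0 -> (e <= d)%N -> indep d Z ->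
  {in Z, forall z, ev z c = 0} -> (ncoef d <= #|` Z| + ncoef (d - e))%N ->
  deg_le d p -> {in Z, forall z, ev z p = 0} ->
  exists2 h, deg_le (d - e) h & p = c * h.
Proof.
move=> hc c0 ed iZ cZ hZ hp pZ.
pose ms := enum {: 'X_{1..2 < (d - e).+1}}.
have sz_ms : size ms = ncoef (d - e) by rewrite -cardE card_bmnm2.
pose F (m : 'X_{1..2 < (d - e).+1}) : {mpoly R[2]} := 'X_[m].
have hF m : deg_le (d - e) (F m) by rewrite /deg_le /F msizeX bmdeg.
have [q|q||u [i lt_i ui]] := @indep_dep _ d Z (p :: [seq c * F m | m <- ms]) iZ; rewrite ?inE.
- by case/orP=> [/eqP->//|/mapP[m _ ->]]; rewrite -(subnKC ed); apply: deg_leM.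
- case/orP=> [/eqP->//|/mapP[m _ ->]] z zZ.
  by rewrite evM cZ // mul0r.
- by rewrite /= size_map sz_ms addnS ltnS.
have m0P : (mdeg (0%MM : 'X_{1..2}) < (d - e).+1)%N by rewrite mdeg0.
pose m0 := BMultinom m0P.
rewrite /= big_ord_recl /= size_map.
pose h := \sum_(j < size ms) u j.+1 *: F (nth m0 ms j).
have -> : \sum_(j < size ms) u (lift ord0 j) *: [seq c * F m | m <- ms]`_j = c * h.
  rewrite mulr_sumr; apply: eq_bigr => j _; rewrite lift0 (nth_map m0) //.
  by rewrite scalerAr.
(* If [p] had coefficient zero, [c] would annihilate a nontrivial combination of distinct
   monomials. *)
move=> eq0; have [u0|u0] := eqVneq (u 0%N) 0; last first.
  exists (- (u 0%N)^-1 *: h); first by apply/deg_leZ/deg_le_sum => j _; apply/deg_leZ/hF.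
  rewrite -scalerAr scaleNr -scalerN -[LHS]scale1r -(mulVf u0) -scalerA; congr (_ *: _).
  by apply/eqP; rewrite -addr_eq0 eq0.
have h0 : h = 0.
  by move/eqP: eq0; rewrite u0 scale0r add0r mulf_eq0 (negPf c0) => /eqP.
case: i lt_i ui => [|i]; first by rewrite u0 eqxx.
rewrite /= size_map ltnS => lt_i /eqP[].
have := congr1 (mcoeff (nth m0 ms i)) h0; rewrite mcoeff0 raddf_sum => <-.
rewrite (bigD1 (Ordinal lt_i)) //= big1 ?addr0 => [|j ji]; rewrite mcoeffZ /F mcoeffX.
  by rewrite eqxx mulr1.
rewrite -bmeqP nth_uniq ?enum_uniq //.
by rewrite (_ : (j == i :> nat) = false) ?mulr0 //; apply: contraNF ji => /eqP ji; apply/eqP/val_inj.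
Qed.

(** In matroid terms a set without coloops, not necessarily minimal and possibly empty; this is the
    property that [circuit_off] preserves. *)
Definition circuit d D := {in D, forall z, ~ separated d D z}.

Definition zeros p X := [fset x in X | ev x p == 0].
Definition off p X := [fset x in X | ev x p != 0].

(** Degenerate curves count: a bound for degree two also covers pairs of lines. *)
Definition curve_bound d k X :=
  forall p, deg_le d p -> p != 0 -> (#|` zeros p X| <= k)%N.

Lemma in_zeros p X x : (x \in zeros p X) = (x \in X) && (ev x p == 0).
Proof. by rewrite !inE. Qed.

Lemma in_off p X x : (x \in off p X) = (x \in X) && (ev x p != 0).
Proof. by rewrite !inE. Qed.

Lemma zerosS p X Y : X `<=` Y -> zeros p X `<=` zeros p Y.
Proof. by move=> /fsubsetP sX; apply/fsubsetP => x; rewrite !in_zeros => /andP[/sX-> ->]. Qed.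

Lemma zeros_sub p X : zeros p X `<=` X.
Proof. by apply/fsubsetP => x; rewrite in_zeros => /andP[]. Qed.

Lemma off_sub p X : off p X `<=` X.
Proof. by apply/fsubsetP => x; rewrite in_off => /andP[]. Qed.

Lemma zeros_vanish p X : {in zeros p X, forall x, ev x p = 0}.
Proof. by move=> x; rewrite in_zeros => /andP[_ /eqP]. Qed.

Lemma card_zeros_off p X : (#|` zeros p X| + #|` off p X|)%N = #|` X|.
Proof.
rewrite -(cardfsID (zeros p X) X); congr (_ + _)%N; congr #|` _|.
  by apply/fsetP => x; rewrite in_fsetI in_zeros; case: (x \in X); case: (ev x p == 0).
by apply/fsetP => x; rewrite in_fsetD in_zeros in_off; case: (x \in X); case: (ev x p == 0).
Qed.

Lemma curve_boundS d k X Y : X `<=` Y -> curve_bound d k Y -> curve_bound d k X.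
Proof. by move=> sX bY p hp p0; apply: leq_trans (fsubset_leq_card (zerosS _ sX)) (bY _ hp p0). Qed.

Lemma curve_boundW d k k' X : (k <= k')%N -> curve_bound d k X -> curve_bound d k' X.
Proof. by move=> kk bX p hp p0; apply: leq_trans (bX _ hp p0) kk. Qed.

(** A separator among the points off [l], multiplied by [l], would be a separator in all of [D]. *)
Lemma circuit_off d D l : circuit d.+1 D -> deg_le 1 l -> circuit d (off l D).
Proof.
move=> cD hl z; rewrite in_off => /andP[zD lz] [p [hp pz pD]]; apply: (cD z zD).
exists (l * p); split; first by rewrite -add1n; apply: deg_leM.
  by rewrite evM mulf_neq0.
move=> y yD yz; rewrite evM; have [->|ly] := eqVneq (ev y l) 0; first by rewrite mul0r.
by rewrite pD ?mulr0 // in_off yD.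
Qed.

Lemma separating_line y z : y != z -> exists l, [/\ deg_le 1 l, ev y l = 0 & ev z l != 0].
Proof.
move=> yz; have [i yzi] : exists i, y ord0 i != z ord0 i.
  apply/existsP; rewrite -negb_forall; apply: contra yz => /forallP yz.
  by apply/eqP/rowP => i; apply/eqP/yz.
exists ('X_i - (y ord0 i)%:MP); split; first by apply/deg_leB/deg_leC/deg_leX.
  by rewrite evB evC /ev mevalXU subrr.
by rewrite evB evC /ev mevalXU subr_eq0 eq_sym.
Qed.

Lemma line_through x y : exists l,
  [/\ deg_le 1 l, l != 0, ev x l = 0 & ev y l = 0].
Proof.
have [|l [l0 hl lZ]] := @vanishing_exists R 1 [fset x; y].
  by rewrite cardfs2; case: (x != y).
by exists l; split=> //; apply: lZ; rewrite !inE eqxx ?orbT.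
Qed.

(** A line through one point of the circuit that misses another leaves a nonempty circuit of lower
    degree with at least one point fewer. *)
Lemma circuit_card d D : circuit d D -> D != fset0 -> (d.+2 <= #|` D|)%N.
Proof.
elim: d D => [|d IH] D cD /fset0Pn[z zD].
  rewrite (cardfsD1 z) zD ltnS cardfs_gt0; apply: contra_notN (cD z zD) => /eqP Dz.
  exists 1; split; rewrite ?ev1 ?oner_eq0 //; first exact: deg_leC.
  by move=> y yD yz; have := in_fset0 y; rewrite -Dz in_fsetD1 yz yD.
have [y yD yz] : exists2 y, y \in D & y != z.
  apply: contrapT => ny; apply: (cD z zD); exists 1.
  split; rewrite ?ev1 ?oner_eq0 //; first exact: deg_leC.
  by move=> y yD yz; case: ny; exists y.
have [l [hl ly lz]] := separating_line yz.
have off0 : off l D != fset0 by apply/fset0Pn; exists z; rewrite in_off zD.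
have := IH _ (circuit_off cD hl) off0; rewrite -(card_zeros_off l D).
have : (0 < #|` zeros l D|)%N.
  by rewrite cardfs_gt0; apply/fset0Pn; exists y; rewrite in_zeros yD ly /=.
lia.
Qed.

Lemma indep_small d Y : (#|` Y| <= d.+1)%N -> indep d Y.
Proof.
move=> hY; apply: contrapT => /circuit_exists[D [sD D0 cD]].
by have := circuit_card cD D0; have := fsubset_leq_card sD; lia.
Qed.

(** The points off a line form a circuit for degree one, so there are at least three of them. If [D]
    had at most five points, every line through two would contain no third and leave exactly three,
    and these turn out to be collinear. *)
Lemma circuit2_card D : curve_bound 1 3 D -> circuit 2 D -> D != fset0 -> (6 <= #|` D|)%N.
Proof.
move=> bD cD D0; have D4 := circuit_card cD D0; rewrite leqNgt; apply/negP => D5.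
have off3 l : deg_le 1 l -> l != 0 -> (3 <= #|` off l D|)%N.
  move=> hl l0; apply: (circuit_card (circuit_off cD hl)); rewrite -cardfs_gt0.
  have := bD l hl l0; have := card_zeros_off l D. lia.
have two l x y : deg_le 1 l -> l != 0 -> x != y -> x \in D -> y \in D ->
    ev x l = 0 -> ev y l = 0 -> zeros l D = [fset x; y] /\ #|` off l D| = 3%N.
  move=> hl l0 xy xD yD lx ly; have sxy : [fset x; y] `<=` zeros l D.
    by apply/fsubsetP => z; rewrite in_zeros !inE => /orP[] /eqP->; rewrite ?xD ?yD ?lx ?ly eqxx.
  have := fsubset_leq_card sxy; have := off3 l hl l0; have := card_zeros_off l D.
  rewrite cardfs2 xy => e1 e2 e3; have z2 : (#|` zeros l D| <= 2)%N by lia.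
  split; last by lia.
  by apply/eqP; rewrite eq_sym eqEfcard sxy cardfs2 xy.
have [x xD] := fset0Pn _ D0.
have [y] : exists y, y \in D `\ x.
  by apply/fset0Pn; rewrite -cardfs_gt0; have := cardfsD1 x D; rewrite xD; lia.
rewrite in_fsetD1 eq_sym => /andP[xy yD].
have [l [hl l0 lx ly]] := line_through x y.
have [_ o3] := two l x y hl l0 xy xD yD lx ly.
have [u uo] : exists u, u \in off l D by apply/fset0Pn; rewrite -cardfs_gt0 o3.
have [v] : exists v, v \in off l D `\ u.
  by apply/fset0Pn; rewrite -cardfs_gt0; have := cardfsD1 u (off l D); rewrite uo; lia.
rewrite in_fsetD1 eq_sym => /andP[uv vo].
have [m [hm m0 mu mv]] := line_through u v.
have uD := fsubsetP (off_sub l D) u uo; have vD := fsubsetP (off_sub l D) v vo.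
have [zm _] := two m u v hm m0 uv uD vD mu mv.
have : off m (off l D) = fset0 \/ off m (off l D) != fset0.
  by have [|] := eqVneq (off m (off l D)) fset0; [left | right].
(* A circuit for degree zero has two points or none, and [m] leaves at most one of the three points
   off [l]. So [m] carries all three, against [zm]. *)
have cuv : circuit 0 (off m (off l D)) by apply/circuit_off/hm/circuit_off.
have suv : [fset u; v] `<=` zeros m (off l D).
  by apply/fsubsetP => z; rewrite in_zeros !inE -!in_off => /orP[] /eqP->; rewrite ?uo ?vo ?mu ?mv eqxx.
case=> [o0|/(circuit_card cuv)]; last first.
  by have := fsubset_leq_card suv; rewrite cardfs2 uv; have := card_zeros_off m (off l D); rewrite o3; clear; lia.
have := card_zeros_off m (off l D); rewrite o0 cardfs0 addn0 o3.
have := fsubset_leq_card (zerosS m (off_sub l D)); rewrite zm cardfs2 uv => h1 h2.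
by move: h1; rewrite h2.
Qed.

End Circuits.

(** * Independence of small sets in general position for conics, cubics and quartics *)

Section GeneralPosition.
Variable R : realFieldType.
Implicit Types (p q f g h l : {mpoly R[2]}) (a b x y z : 'rV[R]_2).
Implicit Types (X Y Z E D S T G F : {fset 'rV[R]_2}) (d e : nat).

Lemma fset_pick2 D : (1 < #|` D|)%N -> exists x y, [/\ x \in D, y \in D & x != y].
Proof.
move=> D1; have [x xD] : exists x, x \in D by apply/fset0Pn; rewrite -cardfs_gt0; lia.
have [y] : exists y, y \in D `\ x.
  by apply/fset0Pn; rewrite -cardfs_gt0; have := cardfsD1 x D; rewrite xD; lia.
by rewrite in_fsetD1 eq_sym => /andP[xy yD]; exists x, y.
Qed.

Lemma circuit_off_line d D : curve_bound 1 3 D -> circuit d.+1 D -> (4 <= #|` D|)%N ->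
  exists l, [/\ deg_le 1 l, l != 0, circuit d (off l D), off l D != fset0 &
    (#|` off l D| + 2 <= #|` D|)%N].
Proof.
move=> bD cD D4; have [x [y [xD yD xy]]] := fset_pick2 (ltnW (ltnW D4)).
have [l [hl l0 lx ly]] := line_through x y; exists l.
have sxy : [fset x; y] `<=` zeros l D.
  by apply/fsubsetP => z; rewrite in_zeros !inE => /orP[] /eqP->; rewrite ?xD ?yD ?lx ?ly eqxx.
have := fsubset_leq_card sxy; rewrite cardfs2 xy => z2.
have := card_zeros_off l D; have := bD l hl l0 => h1 h2.
split=> //; first exact: circuit_off.
  by rewrite -cardfs_gt0; lia.
lia.
Qed.

Lemma indep2_of5 F : curve_bound 1 3 F -> (#|` F| <= 5)%N -> indep 2 F.
Proof.
move=> bF F5; apply: contrapT => /circuit_exists[D [sD D0 cD]].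
have := circuit2_card (curve_boundS sD bF) cD D0; have := fsubset_leq_card sD; lia.
Qed.

(** A line through two points of a circuit would leave a circuit for conics with at most five
    points. *)
Lemma indep3_of7 F : curve_bound 1 3 F -> (#|` F| <= 7)%N -> indep 3 F.
Proof.
move=> bF F7; apply: contrapT => /circuit_exists[D [sD D0 cD]].
have D5 := circuit_card cD D0; have bD := curve_boundS sD bF.
have [l [hl l0 cl ol0 ol]] := circuit_off_line bD cD (ltnW D5).
have := circuit2_card (curve_boundS (off_sub l D) bD) cl ol0.
have := fsubset_leq_card sD; lia.
Qed.

Lemma circuit_vanish d D z p : circuit d D -> z \in D -> deg_le d p ->
  {in D `\ z, forall y, ev y p = 0} -> ev z p = 0.
Proof.
move=> cD zD hp pD; apply/eqP; apply: contra_notT (cD z zD) => pz; exists p; split=> // y yD yz.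
by apply: pD; rewrite in_fsetD1 yz.
Qed.

(* In a circuit of at most eight points the points off a line through two of them form a circuit for conics, so they are six points on a conic; two such conics share five points, hence coincide and contain seven points. *)
Lemma indep3_of8 E : curve_bound 1 3 E -> curve_bound 2 6 E -> (#|` E| <= 8)%N -> indep 3 E.
Proof.
move=> bE cE E8; apply: contrapT => /circuit_exists[D [sD D0 cD]].
have D5 := circuit_card cD D0; have D8 := fsubset_leq_card sD.
have bD := curve_boundS sD bE; have kD := curve_boundS sD cE.
have conic x y : x \in D -> y \in D -> x != y ->
    #|` D| = 8%N /\ exists q, [/\ deg_le 2 q, q != 0 & {in D `\ x `\ y, forall z, ev z q = 0}].
  move=> xD yD xy; have [l [hl l0 lx ly]] := line_through x y.
  have sxy : [fset x; y] `<=` zeros l D.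
    by apply/fsubsetP => z; rewrite in_zeros !inE => /orP[] /eqP->; rewrite ?xD ?yD ?lx ?ly eqxx.
  have := fsubset_leq_card sxy; rewrite cardfs2 xy => z2.
  have zo := card_zeros_off l D; have z3 := bD l hl l0.
  have co := circuit_off cD hl.
  have o0 : off l D != fset0 by rewrite -cardfs_gt0; lia.
  have o6 := circuit2_card (curve_boundS (off_sub l D) bD) co o0.
  have zE : zeros l D = [fset x; y].
    by apply/eqP; rewrite eq_sym eqEfcard sxy cardfs2 xy; apply: (@leq_trans 2) => //; move: zo o6 D8 E8; clear; lia.
  split; first by move: zo o6 z2 D8 E8; clear; lia.
  have oE : off l D = D `\ x `\ y.
    apply/fsetP => z; rewrite !in_fsetD1.
    have := in_zeros l D z; rewrite zE !inE; have := in_off l D z.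
    case: (z \in off l D) => /esym; case: (z == x) => /=; case: (z == y) => //=; by case: (z \in D) => //=; case: eqP.
  have [u uo] := fset0Pn _ o0.
  have [|q [q0 hq qV]] := @vanishing_exists _ 2 (off l D `\ u).
    by have := cardfsD1 u (off l D); rewrite uo /ncoef; change 'C(4, 2) with 6%N; move: zo z2 D8 E8; clear; lia.
  exists q; split=> // z; rewrite -oE => zo'; have [->|zu] := eqVneq z u.
    exact: circuit_vanish co uo hq qV.
  by apply: qV; rewrite in_fsetD1 zu.
have [x [y [xD yD xy]]] := fset_pick2 (ltnW (ltnW (ltnW D5))).
have [Dcard [q [hq q0 qV]]] := conic x y xD yD xy.
have [y'] : exists y', y' \in D `\ x `\ y.
  apply/fset0Pn; rewrite -cardfs_gt0.
  have := cardfsD1 x D; have := cardfsD1 y (D `\ x); rewrite xD in_fsetD1 yD eq_sym xy Dcard /=; lia.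
rewrite !in_fsetD1 => /and3P[y'y y'x y'D].
have [_ [q' [hq' q'0 q'V]]] := conic x y' xD y'D (ltac:(by rewrite eq_sym)).
pose F := D `\ x `\ y `\ y'.
have F5 : #|` F| = 5%N.
  have := cardfsD1 x D; have := cardfsD1 y (D `\ x); have := cardfsD1 y' (D `\ x `\ y).
  rewrite !in_fsetD1 xD yD y'D y'y y'x eq_sym xy Dcard /= -/F; clear; lia.
have sFD : F `<=` D by do 3![apply: fsubset_trans (fsubD1set _ _) _].
have iF : indep 2 F by apply: indep2_of5 (curve_boundS sFD bD) _; rewrite F5.
have [|||c qE] := proportional iF _ hq hq' _ _ q'0.
- by rewrite F5.
- by move=> z; rewrite !in_fsetD1 => /and4P[_ zy zx zD]; apply: qV; rewrite !in_fsetD1 zy zx.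
- by move=> z; rewrite !in_fsetD1 => /and4P[zy' _ zx zD]; apply: q'V; rewrite !in_fsetD1 zy' zx.
have sz : D `\ x `<=` zeros q D.
  apply/fsubsetP => z zDx; rewrite in_zeros; move: zDx; rewrite in_fsetD1 => /andP[zx zD]; rewrite zD /=.
  have [->|zy] := eqVneq z y; last by rewrite qV // !in_fsetD1 zy zx.
  by rewrite qE evZ q'V ?mulr0 // !in_fsetD1 eq_sym y'y eq_sym xy.
have := fsubset_leq_card sz; have := kD q hq q0; have := cardfsD1 x D; rewrite xD Dcard; clear; lia.
Qed.

(** A line through two points of a circuit would leave a circuit for cubics with at most eight
    points, which [indep3_of8] excludes. *)
Lemma indep4_of10 X : curve_bound 1 3 X -> curve_bound 2 6 X -> (#|` X| <= 10)%N -> indep 4 X.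
Proof.
move=> bX cX X10; apply: contrapT => /circuit_exists[D [sD D0 cD]].
have D6 := circuit_card cD D0; have bD := curve_boundS sD bX; have kD := curve_boundS sD cX.
have [l [hl l0 cl /fset0Pn[z zo] ol]] := circuit_off_line bD cD (ltnW (ltnW D6)).
apply: (cl z zo); apply: indep3_of8 zo.
- exact: curve_boundS (off_sub l D) bD.
- exact: curve_boundS (off_sub l D) kD.
- by have := fsubset_leq_card sD; lia.
Qed.

End GeneralPosition.

(** * Base points of a pencil of cubics *)

Section NinePoints.
Variable R : realFieldType.
Implicit Types (p q f g h l m : {mpoly R[2]}) (a b x y z : 'rV[R]_2).
Implicit Types (X Y Z E D S T G F : {fset 'rV[R]_2}) (d e : nat).

Lemma fsubset_card (K : choiceType) (Y : {fset K}) n : (n <= #|` Y|)%N ->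
  exists2 Y', Y' `<=` Y & #|` Y'| = n.
Proof.
move=> nY; exists [fset x in take n Y].
  by apply/fsubsetP => x; rewrite !inE => /mem_take.
by rewrite card_fseq undup_id ?take_uniq ?fset_uniq // size_takel.
Qed.

Definition free2 f g := forall s t : R, s *: f + t *: g = 0 -> s = 0 /\ t = 0.

Lemma free2_not_scale f g c : free2 f g -> f <> c *: g.
Proof.
move=> fr fE; have [|/eqP] := fr 1 (- c); first by rewrite scale1r fE scaleNr subrr.
by rewrite oner_eq0.
Qed.

Lemma free2_neq0 f g : free2 f g -> g != 0.
Proof.
move=> fr; apply/eqP => g0; have [|_ /eqP] := fr 0 1; first by rewrite g0 scaler0 scale0r addr0.
by rewrite oner_eq0.
Qed.

Lemma free2C f g : free2 f g -> free2 g f.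
Proof. by move=> fr s t; rewrite addrC => /fr[]. Qed.

Definition affine (c u v : R) : {mpoly R[2]} := c%:MP + u *: 'X_ord0 + v *: 'X_ord_max.

Lemma affine_deg c u v : deg_le 1 (affine c u v).
Proof. by apply/deg_leD/deg_leZ/deg_leX => //; apply/deg_leD/deg_leZ/deg_leX => //; apply: deg_leC. Qed.

Lemma ev_affine c u v a : ev a (affine c u v) = c + u * a ord0 ord0 + v * a ord0 ord_max.
Proof. by rewrite !evE /ev !mevalXU. Qed.

Definition pt (s t : R) : 'rV[R]_2 := \row_(i < 2) (if i == ord0 then s else t).

Lemma ev_affine_pt c u v s t : ev (pt s t) (affine c u v) = c + u * s + v * t.
Proof. by rewrite ev_affine !mxE. Qed.

Lemma affine_eq0 c u v : affine c u v = 0 -> [/\ c = 0, u = 0 & v = 0].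
Proof.
move=> l0; have h s t : c + u * s + v * t = 0 by rewrite -ev_affine_pt l0 ev0.
have := h 0 0; have := h 1 0; have := h 0 1; rewrite !mulr0 !mulr1 !addr0 => h1 h2 h3.
by move: h1 h2; rewrite h3 !add0r.
Qed.

(** Five points because [no_linear_syzygy] needs four to divide a cubic by the line and may lose one
    to the other linear form. *)
Lemma affine_zeros c u v : (u != 0) || (v != 0) ->
  exists2 Y : {fset 'rV[R]_2}, #|` Y| = 5%N & {in Y, forall y, ev y (affine c u v) = 0}.
Proof.
move=> uv; have n0 : u ^+ 2 + v ^+ 2 != 0.
  by rewrite paddr_eq0 ?sqr_ge0 // !sqrf_eq0 negb_and.
(* The foot of the perpendicular from the origin, moved by multiples of the direction [(- v, u)]. *)
pose P (i : nat) : 'rV[R]_2 := pt (- c * u / (u ^+ 2 + v ^+ 2) - v *+ i) (- c * v / (u ^+ 2 + v ^+ 2) + u *+ i).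
have P_inj : injective P.
  move=> i j /rowP ij; have := ij ord0; have := ij ord_max; rewrite !mxE /=.
  move=> /addrI hu /addrI/oppr_inj hv; apply/eqP; case/orP: uv => [u0|v0].
    by move/eqP: hu; rewrite -[u *+ i]mulr_natr -[u *+ j]mulr_natr (inj_eq (mulfI u0)) eqr_nat.
  by move/eqP: hv; rewrite -[v *+ i]mulr_natr -[v *+ j]mulr_natr (inj_eq (mulfI v0)) eqr_nat.
exists [fset P i | i in iota 0 5].
  by rewrite card_in_imfset //= => i j _ _; apply: P_inj.
move=> y /imfsetP[i _ ->]; rewrite ev_affine_pt -[u *+ i]mulr_natr -[v *+ i]mulr_natr.
by field.
Qed.

Lemma line_unique l m x y : deg_le 1 l -> deg_le 1 m -> l != 0 -> x != y ->
  ev x l = 0 -> ev y l = 0 -> ev x m = 0 -> ev y m = 0 -> exists c, m = c *: l.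
Proof.
move=> hl hm l0 xy lx ly mx my; apply: (@proportional _ 1 [fset x; y]) => //.
- by apply: indep_small; rewrite cardfs2 xy.
- by rewrite cardfs2 xy.
- by move=> z; rewrite !inE => /orP[] /eqP->.
- by move=> z; rewrite !inE => /orP[] /eqP->.
Qed.

(** Two common zeros of [l] and [m] would make [m] a multiple of [l], and then [f] a multiple of
    [g]. With at most one, [l] divides [g], so [g = l * h] and [f = - (m * h)]; a base point off the
    conic [h] is a common zero of [l] and [m], so [h] contains seven of the eight base points. *)
Lemma no_linear_syzygy X f g c u v m : free2 f g -> deg_le 3 f -> deg_le 3 g ->
  {in X, forall x, ev x f = 0} -> {in X, forall x, ev x g = 0} ->
  curve_bound 2 6 X -> (8 <= #|` X|)%N -> (u != 0) || (v != 0) -> deg_le 1 m ->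
  affine c u v * f + m * g <> 0.
Proof.
move=> fr hf hg fX gX bX X8 uv hm; set l := affine c u v => syz.
have hl : deg_le 1 l by apply: affine_deg.
have l0 : l != 0.
  by apply/eqP => /affine_eq0[_ u0 v0]; move: uv; rewrite u0 v0 eqxx.
have common x y : x != y -> ev x l = 0 -> ev y l = 0 -> ev x m = 0 -> ev y m = 0 -> False.
  move=> xy lx ly mx my; have [k mE] := line_unique hl hm l0 xy lx ly mx my.
  move/eqP: syz; rewrite mE -scalerAl scalerAr -mulrDr mulf_eq0 (negPf l0) /= => /eqP eq0.
  by have [|/eqP] := fr 1 k; rewrite ?scale1r ?oner_eq0.
have [Y Y5 lY] := affine_zeros c uv.
have zm : (#|` zeros m Y| <= 1)%N.
  rewrite leqNgt; apply/negP => /fset_pick2[x [y]]; rewrite !in_zeros.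
  move=> [/andP[xY /eqP mx] /andP[yY /eqP my] xy].
  by apply: common xy _ _ mx my; apply: lY.
have [|Z sZ Z4] := @fsubset_card _ (off m Y) 4.
  by have := card_zeros_off m Y; rewrite Y5; lia.
have [h hh gE] : exists2 h, deg_le 2 h & g = l * h.
  apply: (@curve_divides _ 3 1 l Z) => //.
  - by apply: indep_small; rewrite Z4.
  - by move=> z /(fsubsetP sZ)/(fsubsetP (off_sub _ _))/lY.
  - by rewrite Z4.
  - move=> z /(fsubsetP sZ) zo; have zY := fsubsetP (off_sub _ _) z zo.
    have := congr1 (ev z) syz; rewrite evD !evM (lY z zY) mul0r add0r ev0 => /eqP.
    by move: zo; rewrite in_off mulf_eq0 => /andP[_ /negPf->] /= /eqP.
have fE : f = - (m * h).
  apply: (mulfI l0); rewrite mulrN; apply/eqP; rewrite -addr_eq0 -[X in _ == X]syz gE.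
  by apply/eqP; ring.
have h0 : h != 0 by apply: contraNneq (free2_neq0 fr) => h0; rewrite gE h0 mulr0.
have := bX h hh h0; have := card_zeros_off h X.
suff : (#|` off h X| <= 1)%N by move: X8; clear; lia.
rewrite leqNgt; apply/negP => /fset_pick2[x [y]]; rewrite !in_off.
move=> [/andP[xX hx] /andP[yX hy] xy].
have lz z : z \in X -> ev z h != 0 -> ev z l = 0.
  by move=> zX hz; have /eqP := gX z zX; rewrite gE evM mulf_eq0 (negPf hz) orbF => /eqP.
have mz z : z \in X -> ev z h != 0 -> ev z m = 0.
  move=> zX hz; have /eqP := fX z zX.
  by rewrite fE evN oppr_eq0 evM mulf_eq0 (negPf hz) orbF => /eqP.
by apply: (common x y); rewrite ?lz ?mz.
Qed.

(* Ten base points of a pencil of cubics would impose ten conditions on quartics, whereas the pencil times the linear forms gives six independent quartics through them in a space of dimension fifteen. *)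
Lemma pencil_base_points E Y f g : curve_bound 1 3 E -> curve_bound 2 6 E -> #|` E| = 8%N ->
  E `<=` Y -> deg_le 3 f -> deg_le 3 g -> free2 f g ->
  {in Y, forall x, ev x f = 0} -> {in Y, forall x, ev x g = 0} -> (#|` Y| <= 9)%N.
Proof.
move=> bE kE E8 sEY hf hg fr fY gY; rewrite leqNgt; apply/negP => X10.
have [X [sEX fX gX Xcard]] : exists X, [/\ E `<=` X, {in X, forall x, ev x f = 0},
    {in X, forall x, ev x g = 0} & #|` X| = 10%N].
  have [|x [y [xD yD xy]]] := @fset_pick2 _ (Y `\` E).
    by rewrite cardfsDS // E8; lia.
  have sY : x |` (y |` E) `<=` Y.
    by rewrite !fsubUset !fsub1set sEY (fsubsetP (fsubsetDl _ _) _ xD) (fsubsetP (fsubsetDl _ _) _ yD).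
  exists (x |` (y |` E)); split; try by move=> z /(fsubsetP sY); auto.
    by apply: fsubset_trans (fsubsetUr _ _); apply: fsubsetUr.
  move: xD yD; rewrite !in_fsetD !cardfsU1 !inE (negPf xy) => /andP[/negPf-> _] /andP[/negPf-> _].
  by rewrite E8.
have g0 := free2_neq0 fr.
(* The bounds are known for [E] only. Four base points on [l] make [l] a factor of [f] and [g]; the
   conic quotients share at least five points of [E] off [l], so they are proportional. *)
have bX : curve_bound 1 3 X.
  move=> l hl l0; rewrite leqNgt; apply/negP => /fsubset_card[Z sZ Z4].
  have lZ : {in Z, forall z, ev z l = 0} by move=> z /(fsubsetP sZ)/zeros_vanish.
  have ZX z : z \in Z -> z \in X by move=> /(fsubsetP sZ)/(fsubsetP (zeros_sub _ _)).
  have divl p : deg_le 3 p -> {in X, forall x, ev x p = 0} -> exists2 h, deg_le 2 h & p = l * h.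
    move=> hp pX; apply: (@curve_divides _ 3 1 l Z) => //.
    - by apply: indep_small; rewrite Z4.
    - by rewrite Z4.
    - by move=> z /ZX/pX.
  have [[f' hf' fE] [g' hg' gE]] := (divl f hf fX, divl g hg gX).
  have [|F sF F5] := @fsubset_card _ (off l E) 5.
    by have := card_zeros_off l E; have := bE l hl l0; move: E8; clear; lia.
  have FE z : z \in F -> z \in X /\ ev z l != 0.
    by move=> /(fsubsetP sF); rewrite in_off => /andP[/(fsubsetP sEX)].
  have iF : indep 2 F.
    apply: indep2_of5; rewrite ?F5 //; apply: curve_boundS bE.
    exact: fsubset_trans sF (off_sub _ _).
  have Fdiv p p' : {in X, forall x, ev x p = 0} -> p = l * p' -> {in F, forall x, ev x p' = 0}.
    move=> pX pE z /FE[zX lz]; apply/eqP; have /eqP := pX z zX.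
    by rewrite pE evM mulf_eq0 (negPf lz).
  have [||||c f'E] := proportional iF _ hf' hg' _ _ _.
  - by rewrite F5.
  - exact: Fdiv fX fE.
  - exact: Fdiv gX gE.
  - by apply: contraNneq g0 => g'0; rewrite gE g'0 mulr0.
  by apply: (@free2_not_scale f g c fr); rewrite fE gE f'E scalerAr.
(* Likewise seven base points on [q] leave linear quotients that share two points of [E] off [q]. *)
have kX : curve_bound 2 6 X.
  move=> q hq q0; rewrite leqNgt; apply/negP => /fsubset_card[Z sZ Z7].
  have qZ : {in Z, forall z, ev z q = 0} by move=> z /(fsubsetP sZ)/zeros_vanish.
  have sZX : Z `<=` X by apply: fsubset_trans sZ (zeros_sub _ _).
  have divq p : deg_le 3 p -> {in X, forall x, ev x p = 0} -> exists2 h, deg_le 1 h & p = q * h.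
    move=> hp pX; apply: (@curve_divides _ 3 2 q Z) => //.
    - by apply: indep3_of7; rewrite ?Z7 //; apply: curve_boundS bX.
    - by rewrite Z7.
    - by move=> z /(fsubsetP sZX)/pX.
  have [[f' hf' fE] [g' hg' gE]] := (divq f hf fX, divq g hg gX).
  have [|F sF F2] := @fsubset_card _ (off q E) 2.
    by have := card_zeros_off q E; have := kE q hq q0; move: E8; clear; lia.
  have FE z : z \in F -> z \in X /\ ev z q != 0.
    by move=> /(fsubsetP sF); rewrite in_off => /andP[/(fsubsetP sEX)].
  have iF : indep 1 F by apply: indep_small; rewrite F2.
  have Fdiv p p' : {in X, forall x, ev x p = 0} -> p = q * p' -> {in F, forall x, ev x p' = 0}.
    move=> pX pE z /FE[zX lz]; apply/eqP; have /eqP := pX z zX.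
    by rewrite pE evM mulf_eq0 (negPf lz).
  have [||||c f'E] := proportional iF _ hf' hg' _ _ _.
  - by rewrite F2.
  - exact: Fdiv fX fE.
  - exact: Fdiv gX gE.
  - by apply: contraNneq g0 => g'0; rewrite gE g'0 mulr0.
  by apply: (@free2_not_scale f g c fr); rewrite fE gE f'E scalerAr.
have iX : indep 4 X by apply: indep4_of10; rewrite ?Xcard.
pose X0 : {mpoly R[2]} := 'X_ord0; pose X1 : {mpoly R[2]} := 'X_ord_max.
have [p|p||c [i lt_i ci]] := @indep_dep _ 4 X [:: f; f * X0; f * X1; g; g * X0; g * X1] iX.
- have hX i : deg_le 1 ('X_i : {mpoly R[2]}) by apply: deg_leX.
  rewrite !inE => /or4P[/eqP->|/eqP->|/eqP->|/or3P[/eqP->|/eqP->|/eqP->]];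
    first [by apply: deg_leW hf | by apply: deg_leW hg | by apply: (@deg_leM _ 3 1) => //; apply: hX].
- rewrite !inE => /or4P[/eqP->|/eqP->|/eqP->|/or3P[/eqP->|/eqP->|/eqP->]] x xX;
    by rewrite ?evM ?(fX x xX) ?(gX x xX) ?mul0r.
- by rewrite Xcard.
rewrite !big_ord_recl big_ord0 /= addr0 => eq0.
pose l := affine (c 0%N) (c 1%N) (c 2); pose m := affine (c 3) (c 4) (c 5).
have {}eq0 : l * f + m * g = 0.
  rewrite -[RHS]eq0 /l /m /affine !mulrDl !mul_mpolyC -!scalerAl -/X0 -/X1.
  by rewrite ![_ * f]mulrC ![_ * g]mulrC !addrA.
have [uv|] := boolP ((c 1%N != 0) || (c 2 != 0)).
  by apply: (no_linear_syzygy fr hf hg fX gX kX _ uv (affine_deg _ _ _)) eq0; rewrite Xcard.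
have [uv _|] := boolP ((c 4 != 0) || (c 5 != 0)).
  rewrite addrC in eq0.
  by apply: (no_linear_syzygy (free2C fr) hg hf gX fX kX _ uv (affine_deg _ _ _)) eq0; rewrite Xcard.
rewrite !negb_or !negbK => /andP[/eqP c4 /eqP c5] /andP[/eqP c1 /eqP c2].
move: eq0; rewrite /l /m /affine c1 c2 c4 c5 !scale0r !addr0 !mul_mpolyC => /fr[c0 c3].
by case: i lt_i ci => [|[|[|[|[|[|//]]]]]] _; rewrite ?c0 ?c1 ?c2 ?c3 ?c4 ?c5 eqxx.
Qed.

End NinePoints.

(** * The Sylvester-Gallai theorem with a non-vertical ordinary line *)

Section SylvesterGallai.
Variables (R : realFieldType) (K : choiceType) (B : {fset K}) (X Y : K -> R).

(* The vertical offset of [z] from the line through [u] and [v]. *)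
Definition gap u v z := Y z - Y u - (Y v - Y u) / (X v - X u) * (X z - X u).

(** The vertical offset between the lines [pr] and [uv] is affine in the abscissa, is zero at [r]
    and equals [gap u v p] at [p]. *)
Lemma gap_shear u v p q r : X u != X v -> X p != X r -> gap u v q = 0 -> gap u v r = 0 ->
  gap p r q * (X r - X p) = - gap u v p * (X r - X q).
Proof.
rewrite /gap => uv pr; set k := (Y v - Y u) / (X v - X u) => hq hr.
have rp0 : X r - X p != 0 by rewrite subr_eq0 eq_sym.
have qE : Y q = Y u + k * (X q - X u) by apply/eqP; rewrite -subr_eq0 opprD addrA hq.
have rE : Y r = Y u + k * (X r - X u) by apply/eqP; rewrite -subr_eq0 opprD addrA hr.
by rewrite qE rE; field.
Qed.

(* Kelly's argument with vertical distances: if every non-vertical connecting line carried three points, a line at minimal positive vertical distance h from a point p would carry one point on each side of p and one point f below or above p; a line of minimal slope through p or f is again at distance h from the other one, and joining the latter to a suitable point of that line gives a smaller slope. *)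
Theorem ordinary_nonvertical_line :
  (forall s t w : R, [|| s != 0, t != 0 | w != 0] ->
     exists2 b, b \in B & s * X b + t * Y b + w != 0) ->
  exists u v, [/\ u \in B, v \in B, X u != X v &
    forall z, z \in B -> gap u v z = 0 -> (X z = X u /\ Y z = Y u) \/ (X z = X v /\ Y z = Y v)].
Proof.
move=> noncol; apply: contrapT => nord.
have third u v : u \in B -> v \in B -> X u != X v ->
    exists z, [/\ z \in B, gap u v z = 0, X z != X u & X z != X v].
  move=> uB vB uv; apply: contrapT => nz; apply: nord; exists u, v; split=> // z zB gz.
  have vu0 : X v - X u != 0 by rewrite subr_eq0 eq_sym.
  have [zu|zu] := eqVneq (X z) (X u).
    by left; split=> //; move: gz; rewrite /gap zu subrr mulr0 subr0 => /eqP; rewrite subr_eq0 => /eqP.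
  have [zv|zv] := eqVneq (X z) (X v); last by case: nz; exists z.
  right; split=> //; move: gz; rewrite /gap zv divfK // => /eqP.
  by rewrite opprB addrA subrK subr_eq0 => /eqP.
(* The hypothesis on linear forms is used three times: for a constant to get a point, for a vertical
   line to get a second abscissa, and for the line [b0 b1] to get a positive distance. *)
have [b0 b0B _] : exists2 b, b \in B & 0 * X b + 0 * Y b + 1 != 0.
  by apply: noncol; rewrite oner_eq0 !orbT.
have [b1 b1B] : exists2 b, b \in B & 1 * X b + 0 * Y b + - X b0 != 0.
  by apply: noncol; rewrite oner_eq0.
rewrite mul1r mul0r addr0 subr_eq0 eq_sym => b01.
pose k := (Y b1 - Y b0) / (X b1 - X b0).
have [p0 p0B gp0] : exists2 b, b \in B & - k * X b + 1 * Y b + (k * X b0 - Y b0) != 0.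
  by apply: noncol; rewrite oner_eq0 orbT.
have {}gp0 : gap b0 b1 p0 != 0 by apply: contra gp0; rewrite /gap -/k => /eqP <-; apply/eqP; ring.
pose T : finType := (B * B * B)%type.
pose P (t : T) := (X (val t.1.1) != X (val t.1.2)) && (gap (val t.1.1) (val t.1.2) (val t.2) != 0).
pose G (t : T) := `|gap (val t.1.1) (val t.1.2) (val t.2)|.
have Pt0 : P ([` b0B], [` b1B], [` p0B]) by rewrite /P /= b01.
case: (arg_minP G Pt0) => [[[u0 v0] q0]] /andP[/= uv0 g0] Gmin.
pose h := G (u0, v0, q0).
have h_gt0 : 0 < h by rewrite normr_gt0.
have hmin u v p : u \in B -> v \in B -> p \in B -> X u != X v -> gap u v p != 0 -> h <= `|gap u v p|.
  move=> uB vB pB uv gp; have := Gmin ([` uB], [` vB], [` pB]).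
  by rewrite /P /= uv gp => /(_ isT).
(* With [q] strictly between [p] and [r] in abscissa, the line [pr] passes [q] at a distance that is
   [h] times a factor strictly between 0 and 1, against minimality. *)
have side u v p q r : u \in B -> v \in B -> p \in B -> q \in B -> r \in B -> X u != X v ->
    `|gap u v p| = h -> gap u v q = 0 -> gap u v r = 0 ->
    0 < (X q - X p) / (X r - X p) < 1 -> False.
  move=> uB vB pB qB rB uv gp gq gr /andP[lt0 lt1].
  have pr : X p != X r.
    by apply: contraTneq lt0 => ->; rewrite subrr invr0 mulr0 ltxx.
  have rp0 : X r - X p != 0 by rewrite subr_eq0 eq_sym.
  have := gap_shear uv pr gq gr => shear.
  have gE : gap p r q = - gap u v p * (1 - (X q - X p) / (X r - X p)).
    by apply: (mulIf rp0); rewrite shear; field.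
  have pos : 0 < 1 - (X q - X p) / (X r - X p) by rewrite subr_gt0.
  have gn0 : gap p r q != 0.
    by rewrite gE mulf_neq0 ?(lt0r_neq0 pos) // oppr_eq0 -normr_gt0 gp.
  have := hmin p r q pB rB qB pr gn0.
  rewrite gE normrM normrN gp (gtr0_norm pos) leNgt => /negP; apply.
  by rewrite gtr_pMr // ltrBlDr ltrDl.
have noL u v p q r : u \in B -> v \in B -> p \in B -> q \in B -> r \in B -> X u != X v ->
    `|gap u v p| = h -> gap u v q = 0 -> gap u v r = 0 -> X q != X r ->
    X q < X p -> X r < X p -> False.
  move=> uB vB pB qB rB uv gp gq gr; case: (ltgtP (X q) (X r)) => // qr _ qp rp.
    apply: (side u v p r q) => //; apply/andP; split.
      by rewrite nmulr_rgt0 ?invr_lt0 subr_lt0.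
    by rewrite ltr_ndivrMr ?subr_lt0 // mul1r ltrD2r.
  apply: (side u v p q r) => //; apply/andP; split.
    by rewrite nmulr_rgt0 ?invr_lt0 subr_lt0.
  by rewrite ltr_ndivrMr ?subr_lt0 // mul1r ltrD2r.
have noR u v p q r : u \in B -> v \in B -> p \in B -> q \in B -> r \in B -> X u != X v ->
    `|gap u v p| = h -> gap u v q = 0 -> gap u v r = 0 -> X q != X r ->
    X p < X q -> X p < X r -> False.
  move=> uB vB pB qB rB uv gp gq gr; case: (ltgtP (X q) (X r)) => // qr _ qp rp.
    apply: (side u v p q r) => //; apply/andP; split.
      by rewrite pmulr_rgt0 ?invr_gt0 subr_gt0.
    by rewrite ltr_pdivrMr ?subr_gt0 // mul1r ltrD2r.
  apply: (side u v p r q) => //; apply/andP; split.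
    by rewrite pmulr_rgt0 ?invr_gt0 subr_gt0.
  by rewrite ltr_pdivrMr ?subr_gt0 // mul1r ltrD2r.
(* The line holds three points with distinct abscissae, and neither side of [p] can take two of
   them; so one lies exactly above or below [p]. *)
have across u v p : u \in B -> v \in B -> p \in B -> X u != X v -> `|gap u v p| = h ->
    exists l f r, [/\ l \in B, f \in B & r \in B] /\
      [/\ gap u v l = 0, gap u v f = 0 & gap u v r = 0] /\ [/\ X l < X p, X f = X p & X p < X r].
  move=> uB vB pB uv gp; have [z [zB gz zu zv]] := third u v uB vB uv.
  have gu : gap u v u = 0 by rewrite /gap !subrr mulr0 subr0.
  have gv : gap u v v = 0 by rewrite /gap divfK ?subrr // subr_eq0 eq_sym.
  have uz : X u != X z by rewrite eq_sym.
  have vz : X v != X z by rewrite eq_sym.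
  have L q r := @noL u v p q r uB vB pB; have Rr q r := @noR u v p q r uB vB pB.
  case: (ltgtP (X u) (X p)) => hu; case: (ltgtP (X v) (X p)) => hv; case: (ltgtP (X z) (X p)) => hz;
    first [ by case: (L u v uB vB uv gp gu gv uv hu hv) | by case: (L u z uB zB uv gp gu gz uz hu hz)
          | by case: (L v z vB zB uv gp gv gz vz hv hz) | by case: (Rr u v uB vB uv gp gu gv uv hu hv)
          | by case: (Rr u z uB zB uv gp gu gz uz hu hz) | by case: (Rr v z vB zB uv gp gv gz vz hv hz)
          | by case/eqP: uv; rewrite hu hv | by case/eqP: uz; rewrite hu hz | by case/eqP: vz; rewrite hv hz
          | by exists u, v, z | by exists u, z, v | by exists v, u, z | by exists v, z, u
          | by exists z, u, v | by exists z, v, u ].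
have [l [f [r [[lB fB rB] [[gl gf gr] [lp fp pr]]]]]] := across _ _ _ (valP u0) (valP v0) (valP q0) uv0 erefl.
have [a [b [aB bB ab [abY xl]]]] : exists a b, [/\ a \in B, b \in B, X a = X b &
    Y b - Y a = h /\ exists2 w, w \in B & X w != X a].
  have hE : `|Y (val q0) - Y f| = h.
    rewrite /h /G /=; congr `|_|; move: gf; rewrite /gap fp => /eqP.
    by rewrite subr_eq0 => /eqP <-; rewrite opprB addrA subrK.
  have [le|lt] := leP (Y f) (Y (val q0)).
    exists f, (val q0); split=> //; first exact: valP.
    split; first by rewrite -hE ger0_norm // subr_ge0.
    by exists l => //; rewrite fp lt_eqF.
  exists (val q0), f; split=> //; first exact: valP.
  split; first by rewrite -hE distrC gtr0_norm // subr_gt0.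
  by exists l => //; rewrite lt_eqF.
case: xl => w0 w0B w0a.
have bE : Y b = Y a + h by rewrite -abY addrC subrK.
pose S : finType := (bool * B)%type.
pose c (t : S) := if t.1 then b else a.
pose slope (t : S) := (Y (val t.2) - Y (c t)) / (X (val t.2) - X a).
have Ps0 : X (val [` w0B]) != X a by [].
have Xc t : X (c t) = X a by rewrite /c; case: t.1.
case: (arg_minP slope (P := fun t : S => X (val t.2) != X a) (i0 := (true, [` w0B]))) => //.
move=> [[] w] /= wa Smin.
  (* To the left of both points the lower one, [a], sees a smaller slope than [b]; to the right the
     upper one does. This decides which point of [across] is used in each case. *)
  have gw : gap b (val w) a = - h.
    by rewrite /gap ab subrr mulr0 subr0 bE opprD addrA subrr sub0r.
  have [||l' [f' [r' [[l'B _ _] [[gl' _ _] [l'a _ _]]]]]] := across b (val w) a bB (valP w) aB.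
  - by rewrite -ab eq_sym.
  - by rewrite gw normrN gtr0_norm.
  have l'0 : X l' - X a != 0 by rewrite subr_eq0 lt_eqF.
  have := Smin (false, [` l'B]); rewrite /= lt_eqF // => /(_ isT).
  have -> : slope (true, w) = (Y l' - Y b) / (X l' - X a).
    by move/eqP: gl'; rewrite /gap -ab subr_eq0 => /eqP ->; rewrite mulfK.
  rewrite /slope /c /= ler_ndivrMr ?subr_lt0 // divfK // lerD2l lerN2 bE.
  by rewrite -[X in (_ <= X) -> _]addr0 lerD2l leNgt h_gt0.
have gw : gap a (val w) b = h.
  by rewrite /gap ab subrr mulr0 subr0 bE addrC addKr.
have [||l' [f' [r' [[_ _ r'B] [[_ _ gr'] [_ _ br']]]]]] := across a (val w) b aB (valP w) bB.
- by rewrite eq_sym.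
- by rewrite gw gtr0_norm.
have ar' : X a < X r' by rewrite ab.
have r'0 : X r' - X a != 0 by rewrite subr_eq0 gt_eqF.
have := Smin (true, [` r'B]); rewrite /= gt_eqF // => /(_ isT).
have -> : slope (false, w) = (Y r' - Y a) / (X r' - X a).
  by move/eqP: gr'; rewrite /gap subr_eq0 => /eqP ->; rewrite mulfK.
rewrite /slope /c /= ler_pdivrMr ?subr_gt0 // divfK // lerD2l lerN2 bE.
by rewrite -[X in (_ <= X) -> _]addr0 lerD2l leNgt h_gt0.
Qed.

End SylvesterGallai.

(** * From a net of cubics to a cubic with nine points *)

Section ExactCubics.
Variable R : realFieldType.
Implicit Types (p q f g h l m : {mpoly R[2]}) (a b x y z : 'rV[R]_2).
Implicit Types (X Y Z E D S T G F A B : {fset 'rV[R]_2}) (d e : nat).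

Lemma fresh_scalar (s : seq R) : exists c, c \notin s.
Proof.
exists (1 + \sum_(x <- s) `|x|); apply/negP => cs.
have le (r : R) : r \in s -> r <= \sum_(x <- s) `|x|.
  move=> rs; rewrite (big_rem _ rs) /= (le_trans (ler_norm r)) // lerDl.
  by apply: sumr_ge0.
by have := le _ cs; rewrite leNgt ltrDr ltr01.
Qed.

(** A vector space over an infinite field is not a finite union of proper subspaces; here these are
    the polynomials vanishing at a given point of [s]. *)
Lemma nonvanishing_combination (V : {mpoly R[2]} -> Prop) (s : seq 'rV[R]_2) :
  V 0 -> (forall p q c, V p -> V q -> V (p + c *: q)) ->
  {in s, forall a, exists2 p, V p & ev a p != 0} ->
  exists2 p, V p & {in s, forall a, ev a p != 0}.
Proof.
move=> V0 VD; elim: s => [|a s IH] hs; first by exists 0.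
have [|p Vp ps] := IH; first by move=> b bs; apply: hs; rewrite inE bs orbT.
have [q Vq aq] := hs a (mem_head _ _).
(* The values of [c] to avoid. Where [q] vanishes the quotient is a harmless 0, and [p] is nonzero
   there. *)
have [c] := fresh_scalar [seq - (ev b p / ev b q) | b <- a :: s].
move=> cs; exists (p + c *: q); first exact: VD.
move=> b bas; rewrite evD evZ; apply: contra cs => /eqP eq0.
have bq : ev b q != 0.
  move: bas; rewrite inE => /orP[/eqP->//|/ps bp].
  by apply: contraNneq bp => bq; move: eq0; rewrite bq mulr0 addr0 => ->.
apply/mapP; exists b => //; apply: (mulIf bq); rewrite mulNr divfK //.
by apply/eqP; rewrite -addr_eq0 addrC eq0.
Qed.

(** Only degree at most three is asked; [raise_degree] restores degree exactly three at the very
    end. *)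
Definition exact_cubic n A :=
  exists p, [/\ deg_le 3 p, p != 0 & #|` zeros p A| = n].

Definition cubic_closure A S :=
  [fset a in A | `[< forall p, deg_le 3 p -> {in S, forall x, ev x p = 0} -> ev a p = 0 >]].

Lemma cubic_closureP A S a : reflect
  (a \in A /\ forall p, deg_le 3 p -> {in S, forall x, ev x p = 0} -> ev a p = 0)
  (a \in cubic_closure A S).
Proof.
rewrite !inE; apply: (iffP andP) => -[aA h]; split=> //; first by move/asboolP: h.
exact/asboolP.
Qed.

Lemma sub_cubic_closure A S : S `<=` A -> S `<=` cubic_closure A S.
Proof. by move=> /fsubsetP SA; apply/fsubsetP => x xS; apply/cubic_closureP; split; auto. Qed.

(** A generic cubic through [S] avoids every point of [A] outside the closure; it is nonzero because
    [n] is less than the size of [A]. *)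
Lemma exact_of_closure A S n : #|` cubic_closure A S| = n -> (n < #|` A|)%N -> exact_cubic n A.
Proof.
move=> Cn nA; set C := cubic_closure A S in Cn.
have sCA : C `<=` A by apply/fsubsetP => x /cubic_closureP[].
pose V p := deg_le 3 p /\ {in S, forall x, ev x p = 0}.
have [|p q c [hp pS] [hq qS]|a|p [hp pS] pC] := @nonvanishing_combination V (A `\` C).
- by split; [apply: deg_le0 | move=> x _; rewrite ev0].
- split; first by apply/deg_leD/deg_leZ.
  by move=> x xS; rewrite evD evZ pS // qS // mulr0 addr0.
- rewrite in_fsetD => /andP[aC aA]; apply: contrapT => nV.
  move/negP: aC; apply; apply/cubic_closureP; split=> // p hp pS; apply: contrapT => /eqP ap.
  by apply: nV; exists p.
have pE : zeros p A = C.
  apply/fsetP => x; rewrite in_zeros; apply/andP/idP => [[xA /eqP px]|xC].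
    by apply: contraT => xC; have := pC x; rewrite in_fsetD xC xA px eqxx => /(_ isT).
  by have [xA cx] := cubic_closureP _ _ _ xC; split=> //; rewrite cx.
exists p; split; rewrite ?pE //; apply: contraTneq nA => p0.
suff -> : A = C by rewrite Cn ltnn.
by rewrite -pE p0; apply/fsetP => x; rewrite in_zeros ev0 eqxx andbT.
Qed.

(** As [g] has no zero in [B], the map to the plane of the net is read in the affine chart
    [(f1 / g, f2 / g)]. Vertical lines are the members with [t = 0]; only these can contain a point
    of [A] outside [S] and [B]. *)
Lemma exact_of_net A B S f1 f2 g : (9 < #|` A|)%N -> S `<=` A -> #|` S| = 7%N ->
  B `<=` A -> {in B, forall b, b \notin S} ->
  (forall p, deg_le 3 p /\ {in S, forall x, ev x p = 0} <->
     exists s t w, p = s *: f1 + t *: f2 + w *: g) ->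
  {in B, forall b, ev b g != 0} ->
  (forall s t w, [|| s != 0, t != 0 | w != 0] ->
     exists2 b, b \in B & ev b (s *: f1 + t *: f2 + w *: g) != 0) ->
  {in B, forall b, curve_bound 1 3 (b |` S) /\ curve_bound 2 6 (b |` S)} ->
  (forall s t w a, t != 0 -> a \in A -> a \notin S -> a \notin B ->
     ev a (s *: f1 + t *: f2 + w *: g) != 0) ->
  exact_cubic 9 A.
Proof.
move=> A9 SA S7 BA BS net gB noncol good away.
have hnet s t w : deg_le 3 (s *: f1 + t *: f2 + w *: g) /\
    {in S, forall x, ev x (s *: f1 + t *: f2 + w *: g) = 0}.
  by apply/net; exists s, t, w.
pose X b := ev b f1 / ev b g; pose Y b := ev b f2 / ev b g.
have evB s t w b : b \in B ->
    ev b (s *: f1 + t *: f2 + w *: g) = (s * X b + t * Y b + w) * ev b g.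
  by move=> /gB gb; rewrite !evD !evZ /X /Y; field.
have sSb b : b \in B -> b |` S `<=` A.
  by move=> bB; rewrite fsubUset fsub1set (fsubsetP BA) ?SA.
have card8 b : b \in B -> #|` b |` S| = 8%N by move=> /BS bS; rewrite cardfsU1 bS S7.
have clo9 b : b \in B -> (#|` cubic_closure A (b |` S)| <= 9)%N.
  move=> bB; have [k1 k2] := good b bB.
  (* The pencil of members through [b]; it is free because no nonzero member of the net vanishes on
     all of [B]. *)
  pose p1 := 1 *: f1 + 0 *: f2 + - X b *: g; pose p2 := 0 *: f1 + 1 *: f2 + - Y b *: g.
  have [hp1 p1S] := hnet 1 0 (- X b); have [hp2 p2S] := hnet 0 1 (- Y b).
  apply: (@pencil_base_points _ (b |` S) _ p1 p2 k1 k2) => //; first exact: card8.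
  - exact/sub_cubic_closure/sSb.
  - move=> s t eq0; have [/andP[/eqP-> /eqP->] //|st] := boolP ((s == 0) && (t == 0)).
    have [|c cB] := noncol s t (- (s * X b + t * Y b)); first by rewrite orbA -negb_and st.
    move/eqP; case; rewrite -[RHS](ev0 c) -eq0; congr ev.
    by rewrite /p1 /p2 -!mul_mpolyC !mpolyCN !mpolyCD !mpolyCM; ring.
  - move=> x /cubic_closureP[xA cx]; apply: cx => // y; rewrite !inE => /orP[/eqP->|/p1S//].
    by rewrite evB // mul1r mul0r addr0 subrr mul0r.
  - move=> x /cubic_closureP[xA cx]; apply: cx => // y; rewrite !inE => /orP[/eqP->|/p2S//].
    by rewrite evB // mul1r mul0r add0r subrr mul0r.
have [[b bB b9]|n9] := pselect (exists2 b, b \in B & #|` cubic_closure A (b |` S)| = 9%N).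
  exact: exact_of_closure b9 A9.
have closed b : b \in B -> cubic_closure A (b |` S) = b |` S.
  move=> bB; apply/eqP; rewrite eq_sym eqEfcard sub_cubic_closure ?sSb //= card8 //.
  have := clo9 b bB; rewrite leq_eqVlt => /orP[/eqP b9|//].
  by case: n9; exists b.
have [|u [v [uB vB uv line]]] := @ordinary_nonvertical_line R _ B X Y.
  move=> s t w /noncol[b bB]; rewrite evB // mulf_eq0 negb_or => /andP[h _].
  by exists b.
pose k := (Y v - Y u) / (X v - X u).
pose p := - k *: f1 + 1 *: f2 + (k * X u - Y u) *: g.
have [hp pS] := hnet (- k) 1 (k * X u - Y u).
have pB b : b \in B -> ev b p = gap X Y u v b * ev b g.
  by move=> bB; rewrite evB // /gap -/k; congr (_ * _); ring.
(* If [b] and [c] have the same image, every cubic through [S] and [c] passes through [b], so [b] is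
   in the closure, which holds nothing beyond [S] and [c]. *)
have same b c : b \in B -> c \in B -> X b = X c -> Y b = Y c -> b = c.
  move=> bB cB Xbc Ybc; have : b \in cubic_closure A (c |` S).
    apply/cubic_closureP; split; first exact: (fsubsetP BA).
    move=> q hq qS; have [|s [t [w qE]]] := (net q).1.
      by split=> // x xS; apply: qS; rewrite !inE xS orbT.
    have := qS c; rewrite !inE eqxx => /(_ isT).
    rewrite qE !evB // Xbc Ybc => /eqP; rewrite mulf_eq0 (negPf (gB c cB)) orbF => /eqP ->.
    by rewrite mul0r.
  by rewrite closed // !inE (negPf (BS b bB)) orbF => /eqP.
have pE : zeros p A = u |` (v |` S).
  apply/fsetP => x; rewrite in_zeros !inE; have [xS|xS] := boolP (x \in S).
    by rewrite !orbT pS // eqxx (fsubsetP SA).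
  rewrite orbF; have [xB|xB] := boolP (x \in B); last first.
    have -> : (x == u) = false by apply: contraNF xB => /eqP->.
    have -> : (x == v) = false by apply: contraNF xB => /eqP->.
    have [xA|//] := boolP (x \in A).
    by apply/negbTE; apply: away xA xS xB; rewrite oner_eq0.
  rewrite (fsubsetP BA) //= pB // mulf_eq0 (negPf (gB x xB)) orbF.
  apply/eqP/orP => [/(line x xB)[[hX hY]|[hX hY]]|[/eqP->|/eqP->]].
  - by left; apply/eqP/same.
  - by right; apply/eqP/same.
  - by rewrite /gap !subrr mulr0 subr0.
  - by rewrite /gap divfK ?subrr // subr_eq0 eq_sym.
exists p; split=> //; last first.
  rewrite pE !cardfsU1 !inE (negPf (BS u uB)) (negPf (BS v vB)) S7 orbF.
  by rewrite (_ : (u == v) = false) //; apply: contraNF uv => /eqP->.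
have [|b bB] := noncol (- k) 1 (k * X u - Y u); first by rewrite oner_eq0 orbT.
by apply: contraNneq => p0; rewrite -/p p0 ev0.
Qed.

End ExactCubics.

(** * Bases of points taken from [A], and the general case *)

Section Nets.
Variable R : realFieldType.
Implicit Types (p q f g h l m : {mpoly R[2]}) (a b x y z w : 'rV[R]_2).
Implicit Types (X Y Z E D S T G F A B : {fset 'rV[R]_2}) (d e : nat).

(** Dual to [indep]: the evaluations at points of [A] span all functionals. For [d = 3] it expresses
    that [A] lies in no cubic. *)
Definition spanning d A :=
  forall p, deg_le d p -> p != 0 -> exists2 a, a \in A & ev a p != 0.

Lemma indep_card d Z : indep d Z -> (#|` Z| <= ncoef d)%N.
Proof.
move=> iZ; rewrite leqNgt; apply/negP => lt_d.
have [p|p||c [i]] := @indep_dep _ d Z [::] iZ; rewrite ?in_nil ?addn0 //.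
Qed.

Lemma indep_add d Z a f : indep d Z -> deg_le d f -> {in Z, forall z, ev z f = 0} ->
  ev a f != 0 -> indep d (a |` Z).
Proof.
move=> iZ hf fZ fa z; rewrite !inE => /orP[/eqP->|zZ].
  by exists f; split=> // y; rewrite !inE => /orP[/eqP->|/fZ//]; rewrite eqxx.
have [p [hp pz pZ]] := iZ z zZ; exists (p - (ev a p / ev a f) *: f); split.
- by apply/deg_leB/deg_leZ.
- by rewrite evB evZ (fZ z) // mulr0 subr0.
- move=> y; rewrite !inE evB evZ => /orP[/eqP-> _|yZ yz]; first by rewrite divfK // subrr.
  by rewrite (fZ y) // pZ // mulr0 subr0.
Qed.

Lemma indep_extend d A Z : spanning d A -> indep d Z -> (#|` Z| < ncoef d)%N ->
  exists a, [/\ a \in A, a \notin Z & indep d (a |` Z)].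
Proof.
move=> sA iZ /vanishing_exists[f [f0 hf fZ]]; have [a aA fa] := sA f hf f0.
exists a; split=> //; first by apply: contraNN fa => /fZ->.
exact: indep_add fa.
Qed.

Lemma spanning_card d A : spanning d A -> (ncoef d <= #|` A|)%N.
Proof.
move=> sA; rewrite leqNgt; apply/negP => /vanishing_exists[f [f0 hf fA]].
by have [a /fA->] := sA f hf f0; rewrite eqxx.
Qed.

(** Here [B] is all of [A] outside [S], so no point goes to infinity. Extending [S] by [a], [b], [c]
    to ten independent points makes the net explicit. *)
Theorem exact_of_good_set A S : spanning 3 A -> (9 < #|` A|)%N -> S `<=` A -> #|` S| = 7%N ->
  (forall b, b \in A -> b \notin S ->
     curve_bound 1 3 (b |` S) /\ curve_bound 2 6 (b |` S)) ->
  exact_cubic 9 A.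
Proof.
move=> sA A9 SA S7 good; set B := A `\` S.
have inB b : (b \in B) = (b \notin S) && (b \in A) by rewrite in_fsetD.
have goodB b : b \in B -> indep 3 (b |` S).
  rewrite inB => /andP[bS bA]; have [k1 k2] := good b bA bS.
  by apply: indep3_of8 => //; rewrite cardfsU1 bS S7.
have iS : indep 3 S.
  have [b bB] : exists b, b \in B by apply/fset0Pn; rewrite -cardfs_gt0 cardfsDS // S7; lia.
  exact: indepS (fsubsetU1 _ _) (goodB b bB).
have [|a [aA aS iSa]] := indep_extend sA iS; first by rewrite S7.
have cSa : #|` a |` S| = 8%N by rewrite cardfsU1 aS S7.
have [|b [bA bSa iSb]] := indep_extend sA iSa; first by rewrite cSa.
have cSb : #|` b |` (a |` S)| = 9%N by rewrite cardfsU1 bSa cSa.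
have [|c [cA cSb' iZ]] := indep_extend sA iSb; first by rewrite cSb.
set Z := c |` _ in iZ; have cZ : #|` Z| = 10%N by rewrite cardfsU1 cSb' cSb.
move: bSa cSb'; rewrite !inE !negb_or => /andP[ba bS] /and3P[cb ca cS].
(* [fa] and [fb] are dual to [a] and [b]. The third generator [g] is instead chosen without zeros in
   [B]; being nonzero at [c], it keeps the interpolation at [c], [a], [b] triangular. *)
have [fa [hfa faa faZ]] : separated 3 Z a by apply: iZ; rewrite !inE eqxx !orbT.
have [fb [hfb fbb fbZ]] : separated 3 Z b by apply: iZ; rewrite !inE eqxx !orbT.
pose V p := deg_le 3 p /\ {in S, forall x, ev x p = 0}.
have V0 : V 0 by split; [apply: deg_le0 | move=> x _; rewrite ev0].
have VD p q k : V p -> V q -> V (p + k *: q).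
  move=> [hp pS] [hq qS]; split; first by apply/deg_leD/deg_leZ.
  by move=> x xS; rewrite evD evZ pS // qS // mulr0 addr0.
have [|g Vg gB] := @nonvanishing_combination R V B V0 VD.
  move=> x xB; have [p [hp px pS]] := goodB x xB x (fset1U1 _ _).
  exists p => //; split=> // y yS; apply: pS; rewrite ?inE ?yS ?orbT //.
  by apply: contraTneq yS => ->; move: xB; rewrite inB => /andP[].
have cB : c \in B by rewrite inB cS.
have Vfa : V fa.
  split=> // x xS; apply: faZ; rewrite ?inE ?xS ?orbT //.
  by apply: contraTneq xS => ->.
have Vfb : V fb.
  split=> // x xS; apply: fbZ; rewrite ?inE ?xS ?orbT //.
  by apply: contraTneq xS => ->.
have [fab fac fba fbc] : [/\ ev b fa = 0, ev c fa = 0, ev a fb = 0 & ev c fb = 0].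
  by split; [apply: faZ|apply: faZ|apply: fbZ|apply: fbZ]; rewrite ?inE ?eqxx ?orbT // eq_sym.
have Vcomb s t r : V (s *: fa + t *: fb + r *: g).
  by apply: (VD) => //; apply: (VD) => //; rewrite -[s *: fa]add0r; apply: (VD).
apply: (@exact_of_net R A B S fa fb g) => //.
- by apply/fsubsetP => x; rewrite inB => /andP[].
- by move=> x; rewrite inB => /andP[].
- move=> p; split=> [[hp pS]|[s [t [r ->]]]]; last exact: Vcomb.
  pose r := ev c p / ev c g; pose s := (ev a p - r * ev a g) / ev a fa.
  pose t := (ev b p - r * ev b g) / ev b fb; exists s, t, r.
  have [hq qS] := VD p _ (-1) (conj hp pS) (Vcomb s t r).
  rewrite scaleN1r in hq qS.
  apply/eqP; rewrite -subr_eq0; apply/eqP; apply: (unisolvent iZ) => //; first by rewrite cZ.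
  have gc := gB c cB.
  move=> x; rewrite !inE => /or4P[/eqP->|/eqP->|/eqP->|/qS//]; rewrite evB !evD !evZ.
  + by rewrite fac fbc !mulr0 !add0r /r divfK // subrr.
  + by rewrite fab mulr0 add0r /t divfK // subrK subrr.
  + by rewrite fba mulr0 addr0 /s divfK // subrK subrr.
- move=> s t r str; have [|x xA px] := sA _ (Vcomb s t r).1.
    apply/eqP => p0; have pz z : ev z (s *: fa + t *: fb + r *: g) = 0 by rewrite p0 ev0.
    have := pz c; rewrite !evD !evZ fac fbc !mulr0 !add0r => /eqP.
    rewrite mulf_eq0 (negPf (gB c cB)) orbF => /eqP r0.
    have := pz b; rewrite !evD !evZ r0 fab mulr0 mul0r add0r addr0 => /eqP.
    rewrite mulf_eq0 (negPf fbb) orbF => /eqP t0.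
    have := pz a; rewrite !evD !evZ r0 t0 !mul0r !addr0 => /eqP.
    rewrite mulf_eq0 (negPf faa) orbF => /eqP s0.
    by move: str; rewrite s0 t0 r0 eqxx.
  exists x => //; rewrite inB xA andbT; apply: contraNN px => xS.
  by rewrite (Vcomb s t r).2.
- by move=> x; rewrite inB => /andP[xS xA]; apply: good.
- by move=> s t r x _ xA xS; rewrite inB xS xA.
Qed.

End Nets.

(** * The case of a line or conic with many points of [A] *)

Section HeavyCurve.
Variable R : realFieldType.
Implicit Types (p q f g h l m : {mpoly R[2]}) (a b x y z : 'rV[R]_2).
Implicit Types (X Y Z E D S T G F A B : {fset 'rV[R]_2}) (d e : nat).

Lemma spanning_basis d A Z : spanning d A -> Z `<=` A -> indep d Z ->
  exists Y, [/\ Z `<=` Y, Y `<=` A, indep d Y & #|` Y| = ncoef d].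
Proof.
move=> sA; have [n] := ubnP (ncoef d - #|` Z|); elim: n Z => // n IH Z ltn ZA iZ.
have := indep_card iZ; rewrite leq_eqVlt => /orP[/eqP cZ|ltZ]; first by exists Z.
have [a [aA aZ iaZ]] := indep_extend sA iZ ltZ.
have [||//|Y [ZY YA iY cY]] := IH (a |` Z).
- by rewrite cardfsU1 aZ; lia.
- by rewrite fsubUset fsub1set aA.
by exists Y; split=> //; apply: fsubset_trans ZY; apply: fsubsetU1.
Qed.

(** [3 * e + 1] zeros on [c] make [c] a factor of a cubic. In the main case [S] is [G] with all but
    one point [w] of [T0]; the freedom in [w] keeps the points off [c] from all lying on one cubic
    of the net. *)
Lemma exact_of_curve e c A G T0 : (0 < e < 3)%N -> deg_le e c -> c != 0 ->
  (9 < #|` A|)%N -> spanning 3 A ->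
  (forall Y, Y `<=` zeros c A -> #|` Y| = (3 * e).+1 -> indep 3 Y) ->
  G `<=` off c A -> #|` G| = (7 - 3 * e)%N ->
  (forall b, b \in off c A -> b \notin G -> indep (3 - e) (b |` G)) ->
  T0 `<=` zeros c A -> #|` T0| = (3 * e).+1 ->
  (forall T b, T `<=` T0 -> #|` T| = (3 * e)%N -> b \in off c A -> b \notin G ->
     curve_bound 1 3 (b |` (T `|` G)) /\ curve_bound 2 6 (b |` (T `|` G))) ->
  exact_cubic 9 A.
Proof.
move=> e03 hc c0 A9 sA iC GA cG iGb TC cT good.
have ek : (ncoef (3 - e) + 3 * e = 9)%N by case: e e03 {hc iC cG iGb cT good} => [|[|[|//]]].
have ek' : (ncoef (3 - e) = 7 - 3 * e + 2)%N by case: e e03 {hc iC cG iGb cT good ek} => [|[|[|//]]].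
have e3 : (e <= 3)%N by lia.
have e2 : (1 + (3 - e) <= 3)%N by lia.
have e2' : (3 - e <= 3)%N by exact: leq_subr.
have G7 : (3 * e + (7 - 3 * e) = 7)%N by lia.
have hM h : deg_le (3 - e) h -> deg_le 3 (c * h).
  by move=> hh; rewrite -(subnKC e3); apply: deg_leM.
have T0c x : x \in T0 -> ev x c = 0 by move=> /(fsubsetP TC)/zeros_vanish.
have offc x : x \in off c A -> ev x c != 0 by rewrite in_off => /andP[].
have divc Y p : Y `<=` zeros c A -> #|` Y| = (3 * e).+1 -> deg_le 3 p ->
    {in Y, forall y, ev y p = 0} -> exists2 h, deg_le (3 - e) h & p = c * h.
  move=> YC cY hp pY; apply: (@curve_divides _ 3 e c Y) => //; first exact: iC.
    by move=> y /(fsubsetP YC)/zeros_vanish.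
  by rewrite cY addnC addnS ek.
have vanish_quot p h x : p = c * h -> ev x c != 0 -> ev x p = 0 -> ev x h = 0.
  by move=> -> cx /eqP; rewrite evM mulf_eq0 (negPf cx) => /eqP.
have sA1 : spanning (3 - e) (off c A).
  move=> h hh h0; have [|a aA] := sA (c * h) (hM h hh); first by rewrite mulf_neq0.
  by rewrite evM mulf_eq0 negb_or => /andP[ca ha]; exists a => //; rewrite in_off aA.
have on_off p Y : Y `<=` zeros c A -> #|` Y| = (3 * e).+1 -> deg_le 3 p ->
    {in Y, forall y, ev y p = 0} -> {in off c A, forall y, ev y p = 0} -> p = 0.
  move=> YC cY hp pY pA1; have [h hh pE] := divc Y p YC cY hp pY.
  have [h0|h0] := eqVneq h 0; first by rewrite pE h0 mulr0.
  have [a aA1] := sA1 h hh h0.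
  by rewrite (vanish_quot p h a pE (offc a aA1) (pA1 a aA1)) eqxx.
(* With the fewest possible points off [c], a cubic through these and [3 * e] points on [c] has its
   nine points: another zero on [c] would make [c] a factor, with a quotient vanishing on all of
   [off c A]. *)
have := spanning_card sA1; rewrite leq_eqVlt => /orP[/eqP cA1|ltA1].
  have [w wT0] : exists w, w \in T0 by apply/fset0Pn; rewrite -cardfs_gt0 cT.
  have cT' : #|` T0 `\ w| = (3 * e)%N by have := cardfsD1 w T0; rewrite wT0; lia.
  have [|f [f0 hf fZ]] := @vanishing_exists _ 3 (off c A `|` (T0 `\ w)).
    apply: (@leq_ltn_trans (#|` off c A| + #|` T0 `\ w|)); last by rewrite -cA1 cT' ek.
    by rewrite cardfsU leq_subr.
  exists f; split=> //; have -> : zeros f A = off c A `|` (T0 `\ w).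
    apply/fsetP => x; rewrite in_zeros in_fsetU; apply/andP/orP => [[xA fx]|]; last first.
      move=> xU; split; last by apply/eqP/fZ; rewrite in_fsetU; apply/orP.
      by case: xU => [|/(fsubsetP (fsubD1set _ _))/(fsubsetP TC)]; apply: fsubsetP; [apply: off_sub|apply: zeros_sub].
    have [xA1|xA1] := boolP (x \in off c A); [by left | right].
    have xC : x \in zeros c A by move: xA1; rewrite in_off in_zeros xA negbK.
    apply: contraT => xT; move/eqP: f0; case; apply: (on_off _ (x |` (T0 `\ w))) => //.
    - by rewrite fsubUset fsub1set xC (fsubset_trans (fsubD1set _ _)).
    - by rewrite cardfsU1 xT cT'.
    - by move=> y; rewrite in_fset1U => /orP[/eqP->|yT]; [apply/eqP | apply: fZ; rewrite in_fsetU yT orbT].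
    - by move=> y yA1; apply: fZ; rewrite in_fsetU yA1.
  rewrite cardfsU -cA1 cT' ek (_ : _ `&` _ = fset0) ?cardfs0 ?subn0 //.
  apply/fsetP => x; rewrite in_fsetI in_fset0; apply/negP => /andP[/offc cx].
  by move=> /(fsubsetP (fsubD1set _ _))/T0c/eqP; apply/negP.
(* Otherwise each point of [T0] is separated by a cubic from the rest of [T0] and all of [off c A].
   Then the eleven points [u], [Gk], [T0] would be independent for cubics, whose dimension is
   ten. *)
have [w wT0 wA] : exists2 w, w \in T0 & forall f, deg_le 3 f ->
    {in off c A, forall y, ev y f = 0} -> {in T0 `\ w, forall y, ev y f = 0} -> f = 0.
  apply: contrapT => nw.
  have sepT w : w \in T0 -> exists f, [/\ deg_le 3 f, ev w f != 0,
      {in off c A, forall y, ev y f = 0} & {in T0 `\ w, forall y, ev y f = 0}].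
    move=> wT0; apply: contrapT => nf; apply: nw; exists w => //; move=> f hf fA1 fT.
    have [fw|fw] := eqVneq (ev w f) 0; last by case: nf; exists f.
    apply: (on_off _ T0) => // y yT0; have [->//|yw] := eqVneq y w.
    by apply: fT; rewrite in_fsetD1 yw.
  have [|Gk [_ GkA iGk cGk]] := spanning_basis sA1 (fsub0set _); first by move=> z; rewrite in_fset0.
  have [u] : exists u, u \in off c A `\` Gk.
    by apply/fset0Pn; rewrite -cardfs_gt0 cardfsDS // cGk subn_gt0.
  rewrite in_fsetD => /andP[uGk uA1].
  (* A separator [p] of some [i] in [Gk], times a line through [i] that misses [u]. As [i] lies in a
     circuit inside [Gk] and [u], [p] cannot vanish at [u]. The degree is at most three because [e]
     is positive. *)
  have [H [hH Hu HGk]] : exists H, [/\ deg_le 3 H, ev u H != 0 & {in Gk, forall y, ev y H = 0}].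
    have [|D [DG D0 cD]] := @circuit_exists _ (3 - e) (u |` Gk).
      by move=> /indep_card; rewrite cardfsU1 uGk cGk ltnn.
    have D2 := circuit_card cD D0.
    have [i iD iu] : exists2 i, i \in D & i != u.
      have [i] : exists i, i \in D `\ u.
        by apply/fset0Pn; rewrite -cardfs_gt0; have := cardfsD1 u D; move: D2; clear; lia.
      by rewrite in_fsetD1 => /andP[]; exists i.
    have iGk' : i \in Gk by have := fsubsetP DG i iD; rewrite in_fset1U (negPf iu).
    have [p [hp pi pGk]] := iGk i iGk'.
    have [l [hl li lu]] := separating_line iu.
    exists (l * p); split.
    - by apply: (deg_leW e2); apply: deg_leM.
    - rewrite evM mulf_neq0 //; apply: contra_notN (cD i iD) => /eqP pu; exists p; split=> // y.
      by move=> /(fsubsetP DG); rewrite in_fset1U => /orP[/eqP->//|]; apply: pGk.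
    - move=> y yGk; rewrite evM; have [->|yi] := eqVneq y i; first by rewrite li mul0r.
      by rewrite pGk // mulr0.
  have [|D [DG D0 cD]] := @circuit_exists _ 3 (u |` (Gk `|` T0)).
    move=> /indep_card; rewrite cardfsU1 in_fsetU negb_or uGk /= cardfsU (_ : _ `&` _ = fset0).
      rewrite cardfs0 subn0 cGk cT addnS ek.
      by case: (boolP (u \in T0)) => [/T0c/eqP|]; [rewrite (negPf (offc u uA1)) | ].
    apply/fsetP => x; rewrite in_fsetI in_fset0; apply/negP => /andP[/(fsubsetP GkA)/offc cx].
    by move=> /T0c/eqP; apply/negP.
  have notT0 x : x \in D -> x \in T0 -> False.
    move=> xD xT0; have [f [hf fx fA1 fT]] := sepT x xT0; apply: (cD x xD); exists f; split=> // y.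
    move=> /(fsubsetP DG); rewrite in_fset1U in_fsetU => /or3P[/eqP->|/(fsubsetP GkA)|yT yx] *; auto.
    by apply: fT; rewrite in_fsetD1 yx.
  have DGk x : x \in D -> x = u \/ x \in Gk.
    move=> xD; have := fsubsetP DG x xD; rewrite in_fset1U in_fsetU => /or3P[/eqP|xG|/(notT0 x xD)//].
      by left.
    by right.
  have uD : u \notin D.
    apply/negP => uD; apply: (cD u uD); exists H; split=> // y /DGk[->|/HGk//].
    by rewrite eqxx.
  have [x xD] := fset0Pn _ D0; have [xu|xGk] := DGk x xD; first by rewrite -xu xD in uD.
  apply: (cD x xD); apply: separatedS (indepW e2' iGk xGk).
  apply/fsubsetP => y yD; have [yu|//] := DGk y yD; first by rewrite -yu yD in uD.
pose T := T0 `\ w.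
have TT0 : T `<=` T0 by apply: fsubD1set.
have cT' : #|` T| = (3 * e)%N by have := cardfsD1 w T0; rewrite wT0 -/T; lia.
have TG x : x \in T -> x \in G -> False.
  by move=> /(fsubsetP TT0)/T0c/eqP cx /(fsubsetP GA)/offc; rewrite cx.
pose S := T `|` G.
have cS : #|` S| = 7%N.
  rewrite /S cardfsU (_ : _ `&` _ = fset0); first by rewrite cardfs0 subn0 cT' cG G7.
  by apply/fsetP => x; rewrite in_fsetI in_fset0; apply/negP => /andP[/TG].
have SA : S `<=` A.
  rewrite fsubUset (fsubset_trans TT0) ?(fsubset_trans TC) ?zeros_sub //.
  by rewrite (fsubset_trans GA) ?off_sub.
have iG : indep (3 - e) G.
  have [b] : exists b, b \in off c A `\` G.
    by apply/fset0Pn; rewrite -cardfs_gt0 cardfsDS // cG subn_gt0 (leq_trans _ ltA1) // ltnS ek' leq_addr.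
  by rewrite in_fsetD => /andP[bG bA]; apply: indepS (fsubsetU1 _ _) (iGb b bA bG).
have [|b1 [b1A b1G iG1]] := indep_extend sA1 iG; first by rewrite cG ek' addn2.
have cG1 : #|` b1 |` G| = (7 - 3 * e).+1 by rewrite cardfsU1 b1G cG.
have [|b2 [b2A b2G iG2]] := indep_extend sA1 iG1; first by rewrite cG1 ek' addn2.
set Gk := b2 |` _ in iG2; have cGk : #|` Gk| = ncoef (3 - e).
  by rewrite cardfsU1 b2G cG1 ek' addn2.
have [h1 [hh1 h1b1 h1G]] : separated (3 - e) Gk b1 by apply: iG2; rewrite !inE eqxx !orbT.
have [|h2 [hh2 h2b2 h2G]] := iG2 b2; first exact: fset1U1.
move: b2G; rewrite in_fset1U negb_or => /andP[b21 b2G].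
have b1B : b1 \in off c A `\` G by rewrite in_fsetD b1G.
have b2B : b2 \in off c A `\` G by rewrite in_fsetD b2G.
pose V h := deg_le (3 - e) h /\ {in G, forall x, ev x h = 0}.
have V0 : V 0 by split; [apply: deg_le0 | move=> x _; rewrite ev0].
have VD p q k : V p -> V q -> V (p + k *: q).
  move=> [hp pG] [hq qG]; split; first by apply/deg_leD/deg_leZ.
  by move=> x xG; rewrite evD evZ pG // qG // mulr0 addr0.
have [|h [hh hG] hB] := @nonvanishing_combination R V (off c A `\` G) V0 VD.
  move=> x; rewrite in_fsetD => /andP[xG xA1].
  have [p [hp px pG]] := iGb x xA1 xG x (fset1U1 _ _); exists p => //; split=> // y yG.
  by apply: pG; rewrite ?fset1Ur //; apply: contraNneq xG => <-.
have h1b2 : ev b2 h1 = 0 by apply: h1G; rewrite ?fset1U1.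
have {}h1G : V h1.
  split=> // y yG; apply: h1G; rewrite ?in_fset1U ?yG ?orbT //.
  by apply: contraNneq b1G => <-.
have SN p : {in T, forall x, ev x p = 0} -> {in G, forall x, ev x p = 0} ->
    {in S, forall x, ev x p = 0}.
  by move=> pT pG x; rewrite in_fsetU => /orP[/pT|/pG].
have TN p : {in T, forall x, ev x p = 0} -> ev w p = 0 -> {in T0, forall x, ev x p = 0}.
  move=> pT pw x xT0; have [->//|xw] := eqVneq x w; apply: pT.
  by rewrite in_fsetD1 xw.
have GkN p : {in G, forall x, ev x p = 0} -> ev b1 p = 0 -> ev b2 p = 0 ->
    {in Gk, forall x, ev x p = 0}.
  by move=> pG p1 p2 x; rewrite !in_fset1U => /or3P[/eqP->|/eqP->|/pG].
have GkGk : [/\ b1 \in Gk, b2 \in Gk & G `<=` Gk].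
  by split; rewrite ?in_fset1U ?eqxx ?orbT //; apply: fsubset_trans (fsubsetU1 _ _) (fsubsetU1 _ _).
have [b1k b2k /fsubsetP Gk_sub] := GkGk.
have GkA1 x : x \in Gk -> x \in off c A.
  by rewrite !in_fset1U => /or3P[/eqP->|/eqP->|/(fsubsetP GA)].
(* Nine points, so a cubic exists. It misses [w]: otherwise [c] would divide it, with a quotient
   vanishing on the basis [Gk]. *)
have [|f [f0 hf fZ]] := @vanishing_exists _ 3 (T `|` Gk).
  apply: (@leq_ltn_trans (#|` T| + #|` Gk|)); first by rewrite cardfsU leq_subr.
  by rewrite cT' cGk addnC ek.
have fT : {in T, forall x, ev x f = 0} by move=> x xT; apply: fZ; rewrite in_fsetU xT.
have fGk : {in Gk, forall x, ev x f = 0} by move=> x xG; apply: fZ; rewrite in_fsetU xG orbT.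
have quot p : deg_le 3 p -> {in T0, forall x, ev x p = 0} ->
    exists h', [/\ deg_le (3 - e) h', p = c * h' &
      forall x, x \in off c A -> ev x p = 0 -> ev x h' = 0].
  move=> hp pT; have [h' hh' pE] := divc T0 p TC cT hp pT; exists h'; split=> // x xA.
  exact: vanish_quot pE (offc x xA).
have fw : ev w f != 0.
  apply: contra f0 => /eqP fw; have [h' [hh' fE h'N]] := quot f hf (TN f fT fw).
  rewrite fE (@unisolvent _ (3 - e) Gk h') ?mulr0 ?cGk // => x xGk.
  by apply: h'N; [apply: GkA1 | apply: fGk].
have Tc x : x \in T -> ev x c = 0 by move=> /(fsubsetP TT0)/T0c.
have wc := T0c w wT0.
have ev_net s t r x : ev x (s *: (c * h1) + t *: f + r *: (c * h)) =
    s * (ev x c * ev x h1) + t * ev x f + r * (ev x c * ev x h).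
  by rewrite !evD !evZ !evM.
have deg_net s t r : deg_le 3 (s *: (c * h1) + t *: f + r *: (c * h)).
  apply: deg_leD (deg_leZ _ (hM h hh)); apply: deg_leD (deg_leZ _ (hM h1 hh1)) (deg_leZ _ hf).
have [hb1 hb2] := (hB b1 b1B, hB b2 b2B).
have [cb1 cb2] := (offc b1 b1A, offc b2 b2A).
have netT s t r x : x \in T -> ev x (s *: (c * h1) + t *: f + r *: (c * h)) = 0.
  by move=> xT; rewrite ev_net Tc // fT // !mul0r !mulr0 !addr0.
have netG s t r x : x \in G -> ev x (s *: (c * h1) + t *: f + r *: (c * h)) = 0.
  by move=> xG; rewrite ev_net h1G.2 // hG // fGk ?Gk_sub // !mulr0 !addr0.
have netw s t r : ev w (s *: (c * h1) + t *: f + r *: (c * h)) = t * ev w f.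
  by rewrite ev_net wc !mul0r !mulr0 add0r addr0.
(* The members divisible by [c] are those with [t = 0], so they become the vertical lines. *)
apply: (@exact_of_net R A (off c A `\` G) S (c * h1) f (c * h)) => //.
- by apply: fsubset_trans (fsubsetDl _ _) (off_sub _ _).
- move=> x; rewrite in_fsetD in_fsetU negb_or => /andP[-> /offc cx]; rewrite andbT.
  by apply: contra cx => /Tc->.
- move=> p; split=> [[hp pS]|[s [t [r ->]]]]; last first.
    by split=> //; apply: SN => x; [apply: netT | apply: netG].
  have pT x : x \in T -> ev x p = 0 by move=> xT; apply: pS; rewrite in_fsetU xT.
  have pG x : x \in G -> ev x p = 0 by move=> xG; apply: pS; rewrite in_fsetU xG orbT.
  (* Subtracting [t *: f] gives zeros on all of [T0], so [c] divides the rest, and the quotient lies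
     in the pencil spanned by [h1] and [h]. *)
  pose t := ev w p / ev w f; pose q := p - t *: f.
  have hq : deg_le 3 q by apply/deg_leB/deg_leZ.
  have [|h' [hh' qE h'N]] := quot q hq.
    apply: TN => [x xT|]; first by rewrite evB evZ pT // fT // mulr0 subr0.
    by rewrite evB evZ divfK // subrr.
  have h'G x : x \in G -> ev x h' = 0.
    move=> xG; apply: h'N; first exact: (fsubsetP GA).
    by rewrite evB evZ pG // fGk ?Gk_sub // mulr0 subr0.
  pose r := ev b2 h' / ev b2 h; pose s := (ev b1 h' - r * ev b1 h) / ev b1 h1.
  exists s, t, r; have : h' - (s *: h1 + r *: h) = 0.
    apply: (unisolvent iG2); rewrite ?cGk //.
      by apply: deg_leB => //; apply: deg_leD; apply: deg_leZ.
    apply: GkN; rewrite ?evB ?evD ?evZ.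
    + by move=> x xG; rewrite evB evD !evZ h'G // h1G.2 // hG // !mulr0 addr0 subr0.
    + by rewrite divfK // subrK subrr.
    + by rewrite h1b2 mulr0 add0r divfK // subrr.
  move/eqP; rewrite subr_eq0 => /eqP h'E.
  have -> : p = q + t *: f by rewrite /q subrK.
  by rewrite qE h'E mulrDr !scalerAr addrAC.
- by move=> x xB; rewrite evM mulf_neq0 // ?hB //; apply: offc; move: xB; rewrite in_fsetD => /andP[].
- move=> s t r str; apply: contrapT => nb.
  have p0 : s *: (c * h1) + t *: f + r *: (c * h) = 0.
    apply: wA => // x; last exact: netT.
    move=> xA; have [/netG//|xG] := boolP (x \in G); apply: contrapT => /eqP px; apply: nb.
    by exists x => //; rewrite in_fsetD xG.
  have := netw s t r; rewrite p0 ev0 => /esym/eqP; rewrite mulf_eq0 (negPf fw) orbF => /eqP t0.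
  have := ev_net s t r b2; rewrite p0 ev0 t0 h1b2 mul0r !mulr0 add0r add0r => /esym/eqP.
  rewrite !mulf_eq0 (negPf cb2) (negPf hb2) !orbF => /eqP r0.
  have := ev_net s t r b1; rewrite p0 ev0 t0 r0 !mul0r !addr0 => /esym/eqP.
  rewrite !mulf_eq0 (negPf cb1) (negPf h1b1) !orbF => /eqP s0.
  by move: str; rewrite s0 t0 r0 eqxx.
- by move=> x; rewrite in_fsetD => /andP[xG xA]; apply: good.
- move=> s t r x t0 xA; rewrite in_fsetU negb_or => /andP[xT xG].
  rewrite in_fsetD xG /= => xA1.
  have xC : x \in zeros c A by move: xA1; rewrite in_off in_zeros xA negbK.
  (* A member through [x] and [T] has [c] as a factor and so vanishes at [w], where its value is
     [t * ev w f]. *)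
  apply/eqP => px; have [|||h' _ pE] := divc (x |` T) _ _ _ (deg_net s t r).
  + by rewrite fsubUset fsub1set xC (fsubset_trans TT0).
  + by rewrite cardfsU1 xT cT'.
  + by move=> y; rewrite in_fset1U => /orP[/eqP->|/netT].
  have /eqP := netw s t r; rewrite pE evM wc mul0r eq_sym mulf_eq0 (negPf t0) /=.
  exact/negP.
Qed.

End HeavyCurve.

(** * Intersections with lines, and tools for selecting points *)

Section Selection.
Variable R : realFieldType.
Implicit Types (p q f g h l m n : {mpoly R[2]}) (a b x y z : 'rV[R]_2).
Implicit Types (X Y Z E D S T G F A B : {fset 'rV[R]_2}) (d e k : nat).

Lemma zerosC p q X : zeros p (zeros q X) = zeros q (zeros p X).
Proof. by apply/fsetP => x; rewrite !in_zeros andbAC. Qed.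

Lemma zerosU p X Y : zeros p (X `|` Y) = zeros p X `|` zeros p Y.
Proof. by apply/fsetP => x; rewrite in_fsetU !in_zeros in_fsetU andb_orl. Qed.

Lemma card_zerosU p X Y : (#|` zeros p (X `|` Y)| <= #|` zeros p X| + #|` zeros p Y|)%N.
Proof. by rewrite zerosU cardfsU leq_subr. Qed.

Lemma card_zeros1 p x : (#|` zeros p [fset x]| <= 1)%N.
Proof. by apply: leq_trans (fsubset_leq_card (zeros_sub _ _)) _; rewrite cardfs1. Qed.

Lemma card_zerosU1 p x X : x \notin X -> ev x p = 0 -> #|` zeros p (x |` X)| = #|` zeros p X|.+1.
Proof.
move=> xX px; rewrite zerosU (_ : zeros p [fset x] = [fset x]).
  by rewrite cardfsU1 in_zeros (negPf xX).
by apply/fsetP => y; rewrite in_zeros in_fset1; have [->|//] := eqVneq y x; rewrite px eqxx.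
Qed.

Lemma zeros1_off p x : ev x p != 0 -> zeros p [fset x] = fset0.
Proof.
move=> px; apply/fsetP => y; rewrite in_zeros in_fset1 in_fset0.
by have [->|//] := eqVneq y x; rewrite (negPf px).
Qed.

Lemma zeros_none p X : {in X, forall x, ev x p != 0} -> zeros p X = fset0.
Proof.
move=> pX; apply/fsetP => y; rewrite in_zeros in_fset0.
by have [/pX/negPf->|] := boolP (y \in X).
Qed.

Lemma curve_boundU1 d k b X : curve_bound d k X -> curve_bound d k.+1 (b |` X).
Proof.
move=> bX p hp p0; apply: leq_trans (card_zerosU _ _ _) _.
by have := card_zeros1 p b; have := bX p hp p0; lia.
Qed.

Lemma line_meet l m X : deg_le 1 l -> deg_le 1 m -> l != 0 ->
  (exists c, m = c *: l) \/ (#|` zeros m (zeros l X)| <= 1)%N.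
Proof.
move=> hl hm l0; have [|/fset_pick2[x [y []]]] := leqP #|` zeros m (zeros l X)| 1; first by right.
rewrite !in_zeros => /andP[/andP[_ /eqP lx] /eqP mx] /andP[/andP[_ /eqP ly] /eqP my] xy.
by left; apply: line_unique xy lx ly mx my.
Qed.

Lemma conic_meet l q X : deg_le 1 l -> deg_le 2 q -> l != 0 ->
  (exists2 h, deg_le 1 h & q = l * h) \/ (#|` zeros q (zeros l X)| <= 2)%N.
Proof.
move=> hl hq l0; have [|/fsubset_card[Z sZ Z3]] := leqP #|` zeros q (zeros l X)| 2; first by right.
left; apply: (@curve_divides _ 2 1 l Z) => //.
- by apply: indep_small; rewrite Z3.
- by move=> z /(fsubsetP sZ)/(fsubsetP (zeros_sub _ _))/zeros_vanish.
- by rewrite Z3.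
- by move=> z /(fsubsetP sZ)/zeros_vanish.
Qed.

Lemma spanning_off d e c A : deg_le e c -> c != 0 -> (e <= d)%N -> spanning d A ->
  spanning (d - e) (off c A).
Proof.
move=> hc c0 ed sA h hh h0; have hM : deg_le d (c * h) by rewrite -(subnKC ed); apply: deg_leM.
have [|a aA] := sA (c * h) hM; first by rewrite mulf_neq0.
by rewrite evM mulf_eq0 negb_or => /andP[ca ha]; exists a => //; rewrite in_off aA.
Qed.

Definition avoid (ps : seq {mpoly R[2]}) X := [fset x in X | all (fun p => ev x p != 0) ps].

Lemma in_avoid ps X x : (x \in avoid ps X) = (x \in X) && all (fun p => ev x p != 0) ps.
Proof. by rewrite !inE. Qed.

Lemma card_avoid ps k X : {in ps, forall p, (#|` zeros p X| <= k)%N} ->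
  (#|` X| <= #|` avoid ps X| + k * size ps)%N.
Proof.
elim: ps => [|p ps IH] hps.
  by rewrite muln0 addn0; apply/fsubset_leq_card/fsubsetP => x xX; rewrite in_avoid xX.
have := IH (fun q qps => hps q (mem_behead (s := p :: ps) qps)).
have := card_zeros_off p (avoid ps X).
have -> : off p (avoid ps X) = avoid (p :: ps) X.
  by apply/fsetP => x; rewrite in_off !in_avoid /= andbAC andbA.
have sX : avoid ps X `<=` X by apply/fsubsetP => x; rewrite in_avoid => /andP[].
have := fsubset_leq_card (zerosS p sX).
have := hps p (mem_head _ _); rewrite /= mulnS; lia.
Qed.

Lemma pair_lines S : exists ns : seq {mpoly R[2]}, [/\ size ns = 'C(#|` S|, 2),
  {in ns, forall n, deg_le 1 n /\ n != 0},
  {in ns, forall n, exists x y, [/\ x \in S, y \in S, x != y, ev x n = 0 & ev y n = 0]} &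
  {in S &, forall x y, x != y -> exists n, [/\ n \in ns, ev x n = 0 & ev y n = 0]}].
Proof.
elim/fset_card_ind: S => S IH; have [->|/fset0Pn[x xS]] := eqVneq S fset0.
  by exists [::]; rewrite cardfs0; split=> // x y; rewrite in_fset0.
have [|ns [sz hns nsS Sns]] := IH (S `\ x); first by have := cardfsD1 x S; rewrite xS; lia.
have /choice[L hL] : forall y, exists l, [/\ deg_le 1 l, l != 0, ev x l = 0 & ev y l = 0].
  by move=> y; apply: line_through.
exists (ns ++ [seq L y | y <- S `\ x]); split.
- by rewrite size_cat size_map sz (cardfsD1 x S) xS add1n binS bin1.
- move=> n; rewrite mem_cat => /orP[/hns//|/mapP[y _ ->]].
  by have [] := hL y.
- move=> n; rewrite mem_cat => /orP[/nsS[y [z [yS zS yz yn zn]]]|/mapP[y yS ->]].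
    by exists y, z; split=> //; apply: (fsubsetP (fsubD1set _ x)).
  have [_ _ xL yL] := hL y; move: yS; rewrite in_fsetD1 => /andP[yx yS].
  by exists x, y; rewrite eq_sym.
- have old y z : y \in S `\ x -> z \in S `\ x -> y != z ->
      exists n, [/\ n \in ns ++ [seq L y | y <- S `\ x], ev y n = 0 & ev z n = 0].
    by move=> yS zS yz; have [n [nns yn zn]] := Sns y z yS zS yz; exists n; rewrite mem_cat nns.
  have new y : y \in S `\ x -> exists n,
      [/\ n \in ns ++ [seq L y | y <- S `\ x], ev x n = 0 & ev y n = 0].
    by move=> yS; exists (L y); have [] := hL y; rewrite mem_cat map_f ?orbT.
  move=> y z yS zS yz; have [yx|yx] := eqVneq y x.
    by rewrite yx; apply: new; rewrite in_fsetD1 -yx eq_sym yz.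
  have [zx|zx] := eqVneq z x; last by apply: old; rewrite ?in_fsetD1 ?yx ?zx.
  have [|n [nns xn yn]] := new y; first by rewrite in_fsetD1 yx.
  by exists n; rewrite zx.
Qed.

Lemma curve_bound_avoid S (ns : seq {mpoly R[2]}) x : curve_bound 1 2 S ->
  {in ns, forall n, deg_le 1 n /\ n != 0} ->
  {in S &, forall y z, y != z -> exists n, [/\ n \in ns, ev y n = 0 & ev z n = 0]} ->
  {in ns, forall n, ev x n != 0} -> curve_bound 1 2 (x |` S).
Proof.
move=> bS hns Sns nsx n hn n0; apply: leq_trans (card_zerosU _ _ _) _.
have [xn|xn] := eqVneq (ev x n) 0; last by rewrite (zeros1_off xn) cardfs0 add0n; apply: bS.
suff h : (#|` zeros n S| <= 1)%N by have := card_zeros1 n x; lia.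
rewrite leqNgt; apply/negP => /fset_pick2[y [z []]]; rewrite !in_zeros.
move=> /andP[yS /eqP yn] /andP[zS /eqP zn] yz.
have [m [mns my mz]] := Sns y z yS zS yz; have [hm m0] := hns m mns.
have [c mE] := line_unique hn hm n0 yz yn zn my mz.
by have := nsx m mns; rewrite mE evZ xn mulr0 eqxx.
Qed.

(** The related pairs form a matching. Each chosen element costs itself and at most one partner, and
    the last needs no room for a partner, whence [2 * k - 1] elements suffice. *)
Lemma unmatched_subset (r : 'rV[R]_2 -> 'rV[R]_2 -> Prop) k Y :
  (forall x y, r x y -> r y x) ->
  (forall x y z, x \in Y -> y \in Y -> z \in Y -> x != y -> x != z -> r x y -> r x z -> y = z) ->
  (2 * k <= #|` Y|.+1)%N ->
  exists T, [/\ T `<=` Y, #|` T| = k &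
    forall x y, x \in T -> y \in T -> x != y -> ~ r x y].
Proof.
move=> rC; elim: k Y => [|k IH] Y rY kY; first by exists fset0; rewrite fsub0set cardfs0.
have [x xY] : exists x, x \in Y by apply/fset0Pn; rewrite -cardfs_gt0; lia.
pose P := [fset y in Y `\ x | `[< r x y >]].
have PY : P `<=` Y `\ x by apply/fsubsetP => y; rewrite !inE => /andP[].
have P1 : (#|` P| <= 1)%N.
  rewrite leqNgt; apply/negP => /fset_pick2[y [z []]]; rewrite !inE.
  move=> /andP[/andP[yx yY] /asboolP ry] /andP[/andP[zx zY] /asboolP rz] /eqP[].
  by apply: (rY x); rewrite // eq_sym.
have YY : Y `\ x `\` P `<=` Y by apply: fsubset_trans (fsubsetDl _ _) (fsubD1set _ _).
have [||T [TY cT Tr]] := IH (Y `\ x `\` P).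
- by move=> y z t /(fsubsetP YY) yY /(fsubsetP YY) zY /(fsubsetP YY) tY; apply: rY.
- by rewrite cardfsDS //; have := cardfsD1 x Y; rewrite xY; lia.
have Tx y : y \in T -> [/\ y != x, y \in Y & ~ r x y].
  move=> /(fsubsetP TY); rewrite in_fsetD in_fsetD1 => /and3P[yP yx yY]; split=> // rxy.
  by move: yP; rewrite !inE yx yY /= => /asboolP.
exists (x |` T); split.
- by rewrite fsubUset fsub1set xY; apply/fsubsetP => y /Tx[].
- rewrite cardfsU1 cT (_ : x \notin T) //; apply/negP => /Tx[].
  by rewrite eqxx.
- move=> y z; rewrite !in_fset1U => /orP[/eqP->|yT] /orP[/eqP->|zT] yz.
  + by rewrite eqxx in yz.
  + by have [] := Tx z zT.
  + by move=> /rC; have [] := Tx y yT.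
  + exact: Tr.
Qed.

End Selection.

(** * The case of a heavy line *)

Section LineAndConic.
Variable R : realFieldType.
Implicit Types (p q f g h l m n : {mpoly R[2]}) (a b x y z u v : 'rV[R]_2).
Implicit Types (X Y Z E D S T G F A B : {fset 'rV[R]_2}) (d e k : nat).

(** If no line has three points of [A], any four will do. Otherwise two points are taken off such a
    line [L] and two on [L], away from the line [n] joining the former. *)
Lemma quadrangle_exists A : spanning 2 A ->
  exists G, [/\ G `<=` A, #|` G| = 4%N & curve_bound 1 2 G].
Proof.
move=> sA; have A6 := spanning_card sA; rewrite /ncoef (_ : 'C(4, 2) = 6%N) // in A6.
have [[L [hL L0 LA]]|nL] := pselect (exists L, [/\ deg_le 1 L, L != 0 & (2 < #|` zeros L A|)%N]); last first.
  have [|G GA cG] := @fsubset_card _ A 4; first exact: leq_trans A6.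
  exists G; split=> // L hL L0; rewrite leqNgt; apply/negP => LG; apply: nL; exists L; split=> //.
  exact: leq_trans (fsubset_leq_card (zerosS _ GA)).
have [y yA Ly] := sA L (deg_leW (leqnSn 1) hL) L0.
(* Any line through [y]. A point missed by the conic [L * m] is off [L] and differs from [y]. *)
have [m [hm m0 ym _]] := line_through y y.
have [b bA] := sA (L * m) (deg_leM hL hm) (mulf_neq0 L0 m0).
rewrite evM mulf_eq0 negb_or => /andP[Lb mb].
have neq_by : b != y by apply: contraNneq mb => ->; rewrite ym.
have [n [hn n0 nb ny]] := line_through b y.
have nL1 : (#|` zeros n (zeros L A)| <= 1)%N.
  have [[c nE]|//] := line_meet A hL hn L0.
  move/eqP: ny; rewrite nE evZ mulf_eq0 (negPf Ly) orbF => /eqP c0.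
  by move: n0; rewrite nE c0 scale0r eqxx.
have [|u [v [uo vo uv]]] := @fset_pick2 _ (off n (zeros L A)).
  by have := card_zeros_off n (zeros L A); move: nL1 LA; clear; lia.
move: uo vo; rewrite !in_off !in_zeros => /andP[/andP[uA /eqP Lu] nu] /andP[/andP[vA /eqP Lv] nv].
have off_L z t : ev z L = 0 -> ev t L != 0 -> z != t.
  by move=> Lz; apply: contraNneq => <-; rewrite Lz.
exists ([fset u; v] `|` [fset b; y]); split.
- by rewrite !fsubUset !fsub1set uA vA bA yA.
- have -> : [fset u; v] `|` [fset b; y] = u |` (v |` [fset b; y]) by rewrite -fsetUA.
  have [ub uy vb vy] : [/\ u != b, u != y, v != b & v != y] by split; apply: off_L.
  by rewrite !cardfsU1 cardfs1 !inE !negb_or uv neq_by ub uy vb vy.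
- move=> k hk k0; apply: leq_trans (card_zerosU _ _ _) _.
  have scale p p' c x : p = c *: p' -> p != 0 -> ev x p' != 0 -> ev x p != 0.
    by move=> -> p0 px; rewrite evZ mulf_neq0 //; apply: contraNneq p0 => ->; rewrite scale0r.
  have c1 : (#|` zeros k [fset u; v]| <= 1)%N \/ zeros k [fset b; y] = fset0.
    have [h1|/fset_pick2[x [z]]] := leqP #|` zeros k [fset u; v]| 1; [by left | move=> [xS zS xz]; right].
    move: xS zS; rewrite !in_zeros => /andP[xS /eqP kx] /andP[zS /eqP kz].
    have LS t : t \in [fset u; v] -> ev t L = 0 by rewrite !inE => /orP[] /eqP->.
    have [c kE] := line_unique hL hk L0 xz (LS x xS) (LS z zS) kx kz.
    by apply: zeros_none => t; rewrite !inE => /orP[] /eqP->; apply: scale kE k0 _.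
  have c2 : (#|` zeros k [fset b; y]| <= 1)%N \/ zeros k [fset u; v] = fset0.
    have [h1|/fset_pick2[x [z]]] := leqP #|` zeros k [fset b; y]| 1; [by left | move=> [xS zS xz]; right].
    move: xS zS; rewrite !in_zeros => /andP[xS /eqP kx] /andP[zS /eqP kz].
    have LS t : t \in [fset b; y] -> ev t n = 0 by rewrite !inE => /orP[] /eqP->.
    have [c kE] := line_unique hn hk n0 xz (LS x xS) (LS z zS) kx kz.
    by apply: zeros_none => t; rewrite !inE => /orP[] /eqP->; apply: scale kE k0 _.
  have l1 : (#|` zeros k [fset u; v]| <= 2)%N.
    by apply: leq_trans (fsubset_leq_card (zeros_sub _ _)) _; rewrite cardfs2 uv.
  have l2 : (#|` zeros k [fset b; y]| <= 2)%N.
    by apply: leq_trans (fsubset_leq_card (zeros_sub _ _)) _; rewrite cardfs2 neq_by.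
  case: c1 c2 => [c1|->] [c2|->]; rewrite ?cardfs0 ?addn0 ?add0n //.
  exact: leq_add c1 c2.
Qed.

Theorem exact_of_line A l : deg_le 1 l -> l != 0 -> (13 <= #|` zeros l A|)%N ->
  spanning 3 A -> exact_cubic 9 A.
Proof.
move=> hl l0 l13 sA; have A10 := spanning_card sA; rewrite /ncoef (_ : 'C(5, 2) = 10%N) // in A10.
have [|G [GA cG bG]] := @quadrangle_exists (off l A); first exact: (@spanning_off _ 3 1).
have Gl x : x \in G -> ev x l != 0 by move=> /(fsubsetP GA); rewrite in_off => /andP[].
have [ns [sz hns nsG Gns]] := pair_lines G.
set X := avoid ns (zeros l A).
have X7 : (7 <= #|` X|)%N.
  suff /card_avoid : {in ns, forall n, (#|` zeros n (zeros l A)| <= 1)%N}.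
    by rewrite sz cG (_ : 'C(4, 2) = 6%N) // -/X; lia.
  move=> n nns; have [hn n0] := hns n nns; have [[c nE]|//] := line_meet A hl hn l0.
  have [x [_ [/Gl lx _ _ /eqP + _]]] := nsG n nns; rewrite nE evZ mulf_eq0 (negPf lx) orbF => /eqP c0.
  by move: n0; rewrite nE c0 scale0r eqxx.
have XA x : x \in X -> x \in zeros l A by rewrite in_avoid => /andP[].
have Xl x : x \in X -> ev x l = 0 by move=> /XA/zeros_vanish.
have XG x : x \in X -> x \notin G by move=> /Xl lx; apply/negP => /Gl; rewrite lx eqxx.
have bX x : x \in X -> curve_bound 1 2 (x |` G).
  move=> xX; apply: (curve_bound_avoid bG hns Gns) => n; move: xX; rewrite in_avoid => /andP[_ /allP].
  exact.
(* On [X] this is a matching: five points of [x] and [G] fix the conic, and it meets [l] in at most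
   two points, since the residual line of a conic containing [l] would hold all four points of
   [G]. *)
pose r x y := exists q, [/\ deg_le 2 q, q != 0, {in G, forall x, ev x q = 0}, ev x q = 0 & ev y q = 0].
have [||| T0 [T0X cT0 T0r]] := @unmatched_subset _ r 4 X.
- by move=> x y [q [hq q0 qG qx qy]]; exists q; split.
- move=> x y z xX yX zX xy xz [q [hq q0 qG qx qy]] [q' [hq' q'0 q'G q'x q'z]]; apply: contrapT => /eqP yz.
  have xG := XG x xX.
  have c5 : #|` x |` G| = 5%N by rewrite cardfsU1 xG cG.
  have i5 : indep 2 (x |` G).
    by apply: indep2_of5; rewrite ?c5 //; apply: curve_boundW (bX x xX).
  have [|||c qE] := proportional i5 _ hq hq' _ _ q'0.
  + by rewrite c5.
  + by move=> t; rewrite in_fset1U => /orP[/eqP->|/qG].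
  + by move=> t; rewrite in_fset1U => /orP[/eqP->|/q'G].
  have [[h hh qh]|] := conic_meet X hl hq l0.
    have h0 : h != 0 by apply: contraNneq q0 => h0; rewrite qh h0 mulr0.
    have := bG h hh h0; suff -> : zeros h G = G by rewrite cG.
    apply/fsetP => t; rewrite in_zeros; have [tG|//] := boolP (t \in G).
    by have := qG t tG; rewrite qh evM => /eqP; rewrite mulf_eq0 (negPf (Gl t tG)).
  have qz : ev z q = 0 by rewrite qE evZ q'z mulr0.
  suff sxyz : x |` [fset y; z] `<=` zeros q (zeros l X).
    by apply/negP; rewrite -ltnNge (leq_trans _ (fsubset_leq_card sxyz)) // cardfsU1 cardfs2 !inE negb_or xy xz yz.
  by apply/fsubsetP => t; rewrite in_fset1U in_fset2 => /or3P[] /eqP->; rewrite !in_zeros ?Xl ?qx ?qy ?qz ?xX ?yX ?zX ?eqxx.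
- by [].
have T0A : T0 `<=` zeros l A by apply/fsubsetP => x /(fsubsetP T0X)/XA.
apply: (@exact_of_curve _ 1 l A G T0) => //.
- by move=> Y _ cY; apply: indep_small; rewrite cY.
- move=> b bA bnG; apply: indep2_of5; first exact: curve_boundU1.
  by rewrite cardfsU1 bnG cG.
move=> T b TT0; rewrite muln1 in_off => cT /andP[_ lb] bnG.
have TX x : x \in T -> x \in X by move=> /(fsubsetP TT0)/(fsubsetP T0X).
have lT : zeros l T = T.
  by apply/fsetP => x; rewrite in_zeros; have [/TX/Xl->|//] := boolP (x \in T); rewrite eqxx.
have cardE p : (#|` zeros p (b |` (T `|` G))| <= #|` zeros p [fset b]| + (#|` zeros p T| + #|` zeros p G|))%N.
  by apply: leq_trans (card_zerosU _ _ _) _; rewrite leq_add2l; apply: card_zerosU.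
(* Extreme cases: a line holds all of [T] alone, or [b] with one point of [T] and one of [G], or [b]
   with two of [G]; a conic holds [b] with 3 + 2, 2 + 3 or 1 + 4 points of [T] and [G]. *)
split=> p hp p0; apply: leq_trans (cardE p) _.
  have := card_zeros1 p b => b1; have := bG p hp p0 => pG.
  have := line_meet T hl hp l0; rewrite lT => -[[c pE]|pT].
    have c0 : c != 0 by apply: contraNneq p0 => c0; rewrite pE c0 scale0r.
    rewrite (zeros1_off (_ : ev b p != 0)) ?(zeros_none (_ : {in G, forall x, ev x p != 0})).
    - by rewrite cardfs0 add0n addn0 -cT; apply/fsubset_leq_card/zeros_sub.
    - by move=> x /Gl lx; rewrite pE evZ mulf_neq0.
    - by rewrite pE evZ mulf_neq0.
  have [T00|/fset0Pn[x]] := eqVneq (zeros p T) fset0; first by rewrite T00 cardfs0; apply: (leq_add b1 pG).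
  rewrite in_zeros => /andP[xT /eqP px]; have := bX x (TX x xT) p hp p0; rewrite card_zerosU1 // ?XG ?TX // => /ltnSE G1.
  exact: (leq_add b1 (leq_add pT G1)).
have := card_zeros1 p b => b1.
have := fsubset_leq_card (zeros_sub p G); rewrite cG => pG.
have := conic_meet T hl hp l0; rewrite lT => -[[h hh pE]|pT].
  have h0 : h != 0 by apply: contraNneq p0 => h0; rewrite pE h0 mulr0.
  have hl_eq Z : {in Z, forall z, ev z l != 0} -> zeros p Z = zeros h Z.
    move=> Zl; apply/fsetP => z; rewrite !in_zeros; have [zZ|//] := boolP (z \in Z).
    by rewrite pE evM mulf_eq0 (negPf (Zl z zZ)).
  have := bG h hh h0; rewrite -hl_eq // => hG.
  by have := fsubset_leq_card (zeros_sub p T); rewrite cT => pT; apply: (leq_add b1 (leq_add pT hG)).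
have [pT1|/fset_pick2[x [y []]]] := leqP #|` zeros p T| 1.
  exact: (leq_add b1 (leq_add pT1 pG)).
rewrite !in_zeros => /andP[xT /eqP px] /andP[yT /eqP py] xy.
suff G3 : (#|` zeros p G| <= 3)%N by apply: (leq_add b1 (leq_add pT G3)).
rewrite leqNgt; apply/negP => pG4; apply: (T0r x y (fsubsetP TT0 x xT) (fsubsetP TT0 y yT) xy).
exists p; split=> // z zG; apply: (@zeros_vanish _ p G).
by rewrite (_ : zeros p G = G) //; apply/eqP; rewrite eqEfcard zeros_sub cG.
Qed.

End LineAndConic.

(** * The case of a heavy conic, and the greedy step of the general case *)

Section ConicAndGeneral.
Variable R : realFieldType.
Implicit Types (p q f g h l m n : {mpoly R[2]}) (a b x y z u v : 'rV[R]_2).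
Implicit Types (X Y Z E D S T G F A B : {fset 'rV[R]_2}) (d e k : nat).

(** Irreducibility enters only through its effect on [A]: no three of the points on [q] are
    collinear. *)
Theorem exact_of_conic A q : deg_le 2 q -> q != 0 -> curve_bound 1 2 (zeros q A) ->
  (13 <= #|` zeros q A|)%N -> spanning 3 A -> exact_cubic 9 A.
Proof.
move=> hq q0 bq q13 sA; have A10 := spanning_card sA; rewrite /ncoef (_ : 'C(5, 2) = 10%N) // in A10.
have [o oA qo] := sA q (deg_leW (leqnSn 2) hq) q0.
(* A matching, since a line through [o] holds at most two of the points on [q]. So no line through
   [o] meets [T0] twice. *)
pose r x y := exists l, [/\ deg_le 1 l, l != 0, ev o l = 0, ev x l = 0 & ev y l = 0].
have qZ x : x \in zeros q A -> ev x q = 0 by move=> /zeros_vanish.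
have xo x : x \in zeros q A -> o != x by move=> /qZ qx; apply: contraNneq qo => ->; rewrite qx.
have [||| T0 [T0X cT0 T0r]] := @unmatched_subset _ r 7 (zeros q A).
- by move=> x y [l [hl l0 lo lx ly]]; exists l; split.
- move=> x y z xX yX zX xy xz [l [hl l0 lo lx ly]] [m [hm m0 mo mx mz]]; apply: contrapT => /eqP yz.
  have [c lE] := line_unique hm hl m0 (xo x xX) mo mx lo lx.
  have lz : ev z l = 0 by rewrite lE evZ mz mulr0.
  suff sxyz : x |` [fset y; z] `<=` zeros l (zeros q A).
    have := leq_trans (fsubset_leq_card sxyz) (bq l hl l0).
    by rewrite cardfsU1 cardfs2 !inE negb_or xy xz yz.
  by apply/fsubsetP => t; rewrite in_fset1U in_fset2 => /or3P[] /eqP->; rewrite in_zeros ?lx ?ly ?lz ?xX ?yX ?zX eqxx.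
- by [].
apply: (@exact_of_curve _ 2 q A [fset o] T0) => //.
- move=> Y YX cY; apply: indep3_of7; last by rewrite cY.
  exact: curve_boundW (curve_boundS YX bq).
- by rewrite fsub1set in_off oA.
- by rewrite cardfs1.
- by move=> b _ bo; apply: indep_small; rewrite cardfsU1 cardfs1 bo.
move=> T b TT0 cT; rewrite in_off => /andP[_ qb] _.
have TX := fsubset_trans TT0 T0X.
have cardE p : (#|` zeros p (b |` (T `|` [fset o]))| <=
    #|` zeros p [fset b]| + (#|` zeros p T| + #|` zeros p [fset o]|))%N.
  by apply: leq_trans (card_zerosU _ _ _) _; rewrite leq_add2l; apply: card_zerosU.
split=> p hp p0; apply: leq_trans (cardE p) _;
    have b1 := card_zeros1 p b; have o1 := card_zeros1 p o.
  have bT := curve_boundS TX bq hp p0.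
  have [po|po] := eqVneq (ev o p) 0; last first.
    by rewrite (zeros1_off po) cardfs0 addn0; apply: (leq_add b1 bT).
  suff T1 : (#|` zeros p T| <= 1)%N by apply: (leq_add b1 (leq_add T1 o1)).
  rewrite leqNgt; apply/negP => /fset_pick2[x [y []]].
  rewrite !in_zeros => /andP[xT /eqP px] /andP[yT /eqP py] xy.
  by apply: (T0r x y (fsubsetP TT0 x xT) (fsubsetP TT0 y yT) xy); exists p; split.
(* Five points of [T] on [p] make [p] proportional to [q], which misses both [b] and [o]. *)
have [T4|/fsubset_card[F FT F5]] := leqP #|` zeros p T| 4.
  exact: (leq_add b1 (leq_add T4 o1)).
have FX : F `<=` zeros q A by apply: fsubset_trans FT (fsubset_trans (zeros_sub _ _) TX).
have iF : indep 2 F by apply: indep2_of5; rewrite ?F5 //; apply: curve_boundW (curve_boundS FX bq).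
have [|||c pE] := proportional iF _ hp hq _ _ q0.
- by rewrite F5.
- by move=> x /(fsubsetP FT)/zeros_vanish.
- by move=> x /(fsubsetP FX)/qZ.
have c0 : c != 0 by apply: contraNneq p0 => c0; rewrite pE c0 scale0r.
rewrite !zeros1_off ?pE ?evZ ?mulf_neq0 // cardfs0 add0n addn0.
by apply: leq_trans (fsubset_leq_card (zeros_sub _ _)) _; rewrite cT.
Qed.

Lemma five_point_conics S : curve_bound 1 2 S -> (#|` S| <= 6)%N ->
  exists qs : seq {mpoly R[2]}, [/\ (size qs <= 6)%N,
    {in qs, forall q, exists F, [/\ F `<=` S, #|` F| = 5%N, deg_le 2 q, q != 0 &
       {in F, forall x, ev x q = 0}]} &
    forall F, F `<=` S -> #|` F| = 5%N -> exists2 q, q \in qs & {in F, forall x, ev x q = 0}].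
Proof.
move=> bS S6.
have /choice[Q hQ] : forall F, exists q, #|` F| = 5%N ->
    [/\ deg_le 2 q, q != 0 & {in F, forall x, ev x q = 0}].
  move=> F; have [F5|/eqP nF5] := eqVneq #|` F| 5%N; last by exists 0.
  by have [|q [q0 hq qF]] := @vanishing_exists R 2 F; [rewrite F5 | exists q].
have [/eqP S6'|nS6] := boolP (#|` S| == 6%N).
  have Sx5 x : x \in S -> #|` S `\ x| = 5%N by have := cardfsD1 x S => + xS; rewrite xS; lia.
  exists [seq Q (S `\ x) | x <- S]; split; first by rewrite size_map.
    move=> q /mapP[x xS ->].
    have [hq q0 qF] := hQ _ (Sx5 x xS); exists (S `\ x); split=> //; [apply: fsubD1set | exact: Sx5].
  move=> F FS F5; have [x] : exists x, x \in S `\` F.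
    by apply/fset0Pn; rewrite -cardfs_gt0 cardfsDS // S6' F5.
  rewrite in_fsetD => /andP[xF xS]; have FE : F = S `\ x.
    apply/eqP; rewrite eqEfcard fsubsetD1 FS xF F5 /=.
    exact: eq_leq (Sx5 x xS).
  by exists (Q F); [rewrite FE; apply: map_f | have [] := hQ F F5].
have [S5|nS5] := eqVneq #|` S| 5%N.
  exists [:: Q S]; split=> // [q|F FS F5].
    by rewrite inE => /eqP->; have [] := hQ S S5; exists S; split.
  have -> : F = S by apply/eqP; rewrite eqEfcard FS F5 S5.
  by exists (Q S); rewrite ?mem_head //; have [] := hQ S S5.
exists [::]; split=> // F FS F5; have := fsubset_leq_card FS; move: nS5 nS6 S6.
by rewrite F5; lia.
Qed.

Lemma general_position_step A S : (250 <= #|` A|)%N ->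
  (forall l, deg_le 1 l -> l != 0 -> (#|` zeros l A| <= 12)%N) ->
  (forall q, deg_le 2 q -> q != 0 -> curve_bound 1 2 (zeros q A) -> (#|` zeros q A| <= 12)%N) ->
  S `<=` A -> (#|` S| <= 6)%N -> curve_bound 1 2 S -> curve_bound 2 5 S ->
  exists x, [/\ x \in A, x \notin S, curve_bound 1 2 (x |` S) & curve_bound 2 5 (x |` S)].
Proof.
move=> A250 lines conics SA S6 bS kS.
have [ns [szn hns nsS Sns]] := pair_lines S.
have [qs [szq hqs Sqs]] := five_point_conics bS S6.
have line10 : {in ns, forall n, (#|` zeros n (A `\` S)| <= 10)%N}.
  move=> n nns; have [hn n0] := hns n nns; have [x [y [xS yS xy nx ny]]] := nsS n nns.
  have sub : x |` (y |` zeros n (A `\` S)) `<=` zeros n A.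
    apply/fsubsetP => t; rewrite !in_fset1U => /or3P[/eqP->|/eqP->|].
    - by rewrite in_zeros nx eqxx (fsubsetP SA).
    - by rewrite in_zeros ny eqxx (fsubsetP SA).
    - by apply: (fsubsetP (zerosS _ (fsubsetDl _ _))).
  have := leq_trans (fsubset_leq_card sub) (lines n hn n0).
  by rewrite !cardfsU1 !in_fset1U !in_zeros !in_fsetD xS yS (negPf xy).
have iF F : F `<=` S -> #|` F| = 5%N -> indep 2 F.
  by move=> FS F5; apply: indep2_of5; rewrite ?F5 //; apply: curve_boundW (curve_boundS FS bS).
(* The bound on conics applies: a line with three points of the conic would split it into two lines,
   and these hold at most four of the five points of [F]. *)
have conic12 : {in qs, forall q, (#|` zeros q (avoid ns (A `\` S))| <= 12)%N}.
  move=> q qqs; have [F [FS F5 hq q0 qF]] := hqs q qqs.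
  have sub : avoid ns (A `\` S) `<=` A.
    by apply/fsubsetP => x; rewrite in_avoid in_fsetD => /andP[/andP[]].
  apply: leq_trans (fsubset_leq_card (zerosS _ sub)) _; apply: conics => // l hl l0.
  rewrite zerosC; have [[h hh qE]|//] := conic_meet A hl hq l0.
  have h0 : h != 0 by apply: contraNneq q0 => h0; rewrite qE h0 mulr0.
  have bF := curve_boundS FS bS; have := leq_add (bF l hl l0) (bF h hh h0).
  have lh : F `<=` zeros l F `|` zeros h F.
    apply/fsubsetP => x xF; rewrite in_fsetU !in_zeros xF /= -mulf_eq0 -evM -qE.
    by rewrite qF.
  have := fsubset_leq_card lh; rewrite cardfsU F5 => lt5 le4.
  by have := leq_trans lt5 (leq_trans (leq_subr _ _) le4).
have [x] : exists x, x \in avoid qs (avoid ns (A `\` S)).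
  apply/fset0Pn; rewrite -cardfs_gt0.
  have := card_avoid line10; have := card_avoid conic12; rewrite cardfsDS //.
  have : (size ns <= 15)%N by rewrite szn; apply: (@leq_trans 'C(6, 2)) => //; apply: leq_bin2l.
  move=> ns15 ineq1 ineq2; have : (0 + 12 * size qs < #|` avoid qs (avoid ns (A `\` S))| + 12 * size qs)%N.
    apply: leq_trans ineq1; rewrite -(ltn_add2r (10 * size ns)); apply: leq_trans ineq2.
    by apply: (@leq_trans (250 - 6)); [lia | apply: leq_sub].
  by rewrite ltn_add2r.
rewrite !in_avoid in_fsetD => /andP[/andP[/andP[xS xA] /allP xns] /allP xqs].
exists x; split=> //; first exact: curve_bound_avoid bS hns Sns xns.
move=> q hq q0; have qS5 := kS q hq q0.
apply: leq_trans (card_zerosU _ _ _) _; have [qx|qx] := eqVneq (ev x q) 0; last first.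
  by rewrite (zeros1_off qx) cardfs0.
have x1 := card_zeros1 q x.
have [q4|q5] := leqP #|` zeros q S| 4; first exact: (leq_add x1 q4).
(* Five points of [S] make [q] proportional to one of the listed conics, all of which miss [x]. *)
have F5 : #|` zeros q S| = 5%N by apply/eqP; rewrite eqn_leq qS5.
have [q' q'qs q'F] := Sqs _ (zeros_sub q S) F5.
have [_ [_ _ hq' q'0 _]] := hqs q' q'qs.
have [||c q'E] := proportional (iF _ (zeros_sub q S) F5) _ hq' hq q'F _ q0.
- by rewrite F5.
- exact: zeros_vanish.
by have := xqs q' q'qs; rewrite q'E evZ qx mulr0 eqxx.
Qed.

End ConicAndGeneral.

(** * Case distinction and passage to degree exactly three *)

Section Assembly.
Variable R : realFieldType.
Implicit Types (p q f g h l m n : {mpoly R[2]}) (a b x y z u v : 'rV[R]_2).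
Implicit Types (X Y Z E D S T G F A B : {fset 'rV[R]_2}) (d e k : nat).

Lemma general_position_set A k : (250 <= #|` A|)%N ->
  (forall l, deg_le 1 l -> l != 0 -> (#|` zeros l A| <= 12)%N) ->
  (forall q, deg_le 2 q -> q != 0 -> curve_bound 1 2 (zeros q A) -> (#|` zeros q A| <= 12)%N) ->
  (k <= 7)%N ->
  exists S, [/\ S `<=` A, #|` S| = k, curve_bound 1 2 S & curve_bound 2 5 S].
Proof.
move=> A250 lines conics; elim: k => [|k IH] k7.
  have z0 p : zeros p fset0 = fset0 by apply/fsetP => x; rewrite in_zeros !in_fset0.
  by exists fset0; split; rewrite ?fsub0set ?cardfs0 // => p _ _; rewrite z0 cardfs0.
have [S [SA cS bS kS]] := IH (ltnW k7).
have [|x [xA xS bxS kxS]] := general_position_step A250 lines conics SA _ bS kS.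
  by rewrite cS.
by exists (x |` S); rewrite fsubUset fsub1set xA cardfsU1 xS cS.
Qed.

Theorem exact_cubic_exists A : (250 <= #|` A|)%N -> spanning 3 A -> exact_cubic 9 A.
Proof.
move=> A250 sA.
have [[l [hl l0 l13]]|nl] :=
    pselect (exists l, [/\ deg_le 1 l, l != 0 & (13 <= #|` zeros l A|)%N]).
  exact: exact_of_line l13 sA.
have [[q [hq q0 bq q13]]|nq] := pselect (exists q,
    [/\ deg_le 2 q, q != 0, curve_bound 1 2 (zeros q A) & (13 <= #|` zeros q A|)%N]).
  exact: exact_of_conic bq q13 sA.
have [|||S [SA cS bS kS]] := @general_position_set A 7 A250.
- by move=> l hl l0; rewrite leqNgt; apply/negP => l13; apply: nl; exists l.
- by move=> q hq q0 bq; rewrite leqNgt; apply/negP => q13; apply: nq; exists q.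
- by [].
apply: exact_of_good_set cS _ => //; first exact: leq_trans A250.
by move=> b _ _; split; apply: curve_boundU1.
Qed.

(* Multiplying by vertical lines that miss [A] raises the degree to exactly [d] without changing the zeros in [A]. *)
Lemma raise_degree d A p : p != 0 -> deg_le d p ->
  exists q, [/\ msize q = d.+1 & forall a, a \in A -> (ev a q == 0) = (ev a p == 0)].
Proof.
move=> p0 hp; have [c cA] := fresh_scalar [seq a ord0 ord0 | a <- A].
pose l : {mpoly R[2]} := 'X_ord0 - c%:MP.
have lA a : a \in A -> ev a l != 0.
  move=> aA; rewrite evB evC /ev mevalXU subr_eq0.
  by apply: contraNneq cA => <-; apply: (map_f (fun a : 'rV[R]_2 => a ord0 ord0)).
have l2 : msize l = 2%N.
  apply/eqP; rewrite eqn_leq (_ : msize l <= 2)%N /=; last by apply/deg_leB/deg_leC/deg_leX.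
  have := @msize_mdeg_lt _ _ l U_(ord0)%MM; rewrite mdeg1; apply.
  by rewrite mcoeff_msupp mcoeffB mcoeffX mcoeffC eqxx mnm1_eq0 mulr0 subr0 oner_eq0.
have l0 : l != 0 by rewrite -msize_poly_eq0 l2.
exists (p * l ^+ (d.+1 - msize p)); split.
  have -> k : msize (p * l ^+ k) = (msize p + k)%N.
    elim: k => [|k IH]; first by rewrite mulr1 addn0.
    by rewrite exprSr mulrA msizeM ?mulf_neq0 ?expf_neq0 // IH l2 addn2 addnS.
  exact: subnKC.
move=> a aA; rewrite evM mulf_eq0 [X in _ || X](_ : _ = false) ?orbF //.
by rewrite [ev a _]rmorphXn expf_eq0 (negPf (lA a aA)) andbF.
Qed.

End Assembly.

Local Open Scope classical_set_scope.
Local Open Scope fset_scope.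

Theorem theorem1p3 (R : realType) (A : {fset 'rV[R]_2}) :
  (250 <= #|` A|)%N ->
  (forall C : set 'rV[R]_2, is_cubic C -> ~ ([set` A] `<=` C)%classic) ->
  exists C : set 'rV[R]_2, is_cubic C /\ #|` [fset x in A | x \in C]| = 9%N.
Proof.
move=> A250 noncubic.
have sA : spanning 3 A.
  move=> p hp p0; apply: contrapT => nA.
  have [q [q4 qp]] := raise_degree A p0 hp.
  apply: (noncubic (zero_set q)); first by exists q.
  move=> a /= aA; apply/eqP; rewrite -[_ == _]/(ev a q == 0) qp //; apply: contrapT => /negP pa.
  by apply: nA; exists a.
have [p [hp p0 <-]] := exact_cubic_exists A250 sA.
have [q [q4 qp]] := raise_degree A p0 hp.
exists (zero_set q); split; first by exists q.
congr #|` _|; apply/fsetP => a; rewrite in_zeros !inE.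
have [aA|//] := boolP (a \in A); rewrite -qp //=.
by apply/asboolP/eqP.
Qed.
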